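(* Let $\mathcal{H}$ be a complex separable Hilbert space and let $(T_1,T_2)$ be a toral $2$-isometric operator-valued weighted shift in the class $\ell^2_{IWP}(\mathcal{H})$ with weights $\{W_I^{(j)}:j=1,2\}_{I\in\mathbb{Z}_+^2}$ such that the initial weights $W_{0,0}^{(1)}$ and $W_{0,0}^{(2)}$ commute. Let $a_1=\|W_{0,0}^{(1)}\|$ and $a_2=\|W_{0,0}^{(2)}\|$. Then, with $E$ the joint spectral measure on $[1,a_1]\times[1,a_2]$ of the commuting pair $(W_{0,0}^{(1)},W_{0,0}^{(2)})$, for all $(m,n)\in\mathbb{Z}_+^2$, $$W_{m,n}^{(1)}=\int_{[1,a_1]\times[1,a_2]}\sqrt{\frac{1+(m+1)(x^2-1)+n(y^2-1)}{1+m(x^2-1)+n(y^2-1)}}\,dE(x,y)$$ and $$W_{m,n}^{(2)}=\int_{[1,a_1]\times[1,a_2]}\sqrt{\frac{1+m(x^2-1)+(n+1)(y^2-1)}{1+m(x^2-1)+n(y^2-1)}}\,dE(x,y).$$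
   Context: $\mathbb{Z}_+$ is the set of nonnegative integers, $B(\mathcal{H})$ the algebra of bounded linear operators on $\mathcal{H}$. $\ell^2_{\mathbb{Z}_+^2}(\mathcal{H})=\bigoplus_{(m,n)\in\mathbb{Z}_+^2}\mathcal{H}\cong\ell^2(\mathbb{Z}_+^2)\otimes\mathcal{H}$, with $e_{m,n}\otimes h$ denoting the element having $h$ in coordinate $(m,n)$ and $0$ elsewhere. The operator-valued weighted shift with weights $W^{(j)}_{m,n}\in B(\mathcal{H})$ is the pair $(T_1,T_2)$ with $T_1(e_{m,n}\otimes h)=e_{m+1,n}\otimes W^{(1)}_{m,n}h$ and $T_2(e_{m,n}\otimes h)=e_{m,n+1}\otimes W^{(2)}_{m,n}h$. For $(m,n)\in\mathbb{Z}_+^2$ define $\mathcal{P}_{m,n}=W_{m-1,n}^{(1)}W_{m-2,n}^{(1)}\cdots W_{0,n}^{(1)}W_{0,n-1}^{(2)}\cdots W_{0,0}^{(2)}$, with $\mathcal{P}_{0,0}=I$. The class $\ell^2_{IWP}(\mathcal{H})$ consists of the operator-valued weighted shifts on $\ell^2_{\mathbb{Z}_+^2}(\mathcal{H})$ with all weights invertible in $B(\mathcal{H})$ and such that $\mathcal{P}_{m,n}$ is positive for every $(m,n)\in\mathbb{Z}_+^2$. A commuting pair $(T_1,T_2)$ of bounded operators is a toral $2$-isometry if $I-T_i^*T_i-T_j^*T_j+T_j^*T_i^*T_iT_j=0$ for all $i,j\in\{1,2\}$ (including $i=j$). The joint spectral measure $E$ of commuting self-adjoint $C_1,C_2$ is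 the projection-valued measure with $C_1=\int x\,dE(x,y)$ and $C_2=\int y\,dE(x,y)$. *)

(* Defs.v *)
From HB Require Import structures.
From mathcomp Require Import all_boot all_order all_algebra complex.
From mathcomp Require Import all_classical all_reals all_analysis.
From mathcomp Require Import ring lra.

Set Implicit Arguments.
Unset Strict Implicit.
Unset Printing Implicit Defensive.

Import Order.TTheory GRing.Theory Num.Theory.
Import numFieldNormedType.Exports.

Local Open Scope classical_set_scope.
Local Open Scope complex_scope.
Local Open Scope ring_scope.

(* In a normed module over R[i] the norm is R[i]-valued, with values that are
   nonnegative real numbers.  Forms of type {dot H for Num.conj} are linear in
   the first argument and conjugate-linear in the second one. *)
HB.mixin Record NormedModule_isInnerProduct (R : realType) (H : Type)
    & CompleteNormedModule R[i] H := {
  dotp : {dot H for Num.conj};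
  dotp_normE : forall x : H, `|x| ^+ 2 = dotp x x
}.

#[short(type="hilbertType")]
HB.structure Definition Hilbert (R : realType) :=
  {H of CompleteNormedModule R[i] H & NormedModule_isInnerProduct R H}.

Notation "''[' x , y ]" := (dotp x y) : ring_scope.

(* complex.Re and complex.Im with result typed in R : realType, so that the
   operations on the result are inferred from the realType structure *)
Definition reC (R : realType) (z : R[i]) : R := complex.Re z.
Definition imC (R : realType) (z : R[i]) : R := complex.Im z.

Section DotRe.
Variables (R : realType) (V : lmodType R[i]) (f : {dot V for Num.conj}).
Implicit Types (x y : V).

Let q x : R := reC (f x x).
Let b x y : R := reC (f x y).

Lemma ReD (u v : R[i]) : reC (u + v) = reC u + reC v :> R.
Proof. by case: u; case: v. Qed.
Lemma ReN (u : R[i]) : reC (- u) = - reC u.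
Proof. by case: u. Qed.
Lemma ReM (u v : R[i]) : reC (u * v) =
  reC u * reC v - imC u * imC v :> R.
Proof. by case: u; case: v. Qed.
Lemma ImD (u v : R[i]) : imC (u + v) = imC u + imC v :> R.
Proof. by case: u; case: v. Qed.
Lemma ImM (u v : R[i]) : imC (u * v) =
  reC u * imC v + imC u * reC v :> R.
Proof. by case: u => a c; case: v => d e. Qed.
Lemma ReJ (u : R[i]) : reC (Num.conj u) = reC u :> R.
Proof. by case: u. Qed.
Lemma ImJ (u : R[i]) : imC (Num.conj u) = - imC u :> R.
Proof. by case: u. Qed.

Lemma reC_norm2 (a : R[i]) : reC (`|a| ^+ 2) = reC a ^+ 2 + imC a ^+ 2.
Proof. by rewrite -add_Re2_Im2. Qed.

Lemma dot_hermC x y : f x y = Num.conj (f y x).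
Proof. by rewrite [LHS]hermitian_subproof expr0 mul1r. Qed.

Lemma dotxx_Im x : imC (f x x) = 0 :> R.
Proof. by apply: ger0_Im; exact: dnorm_ge0. Qed.

Lemma dotxx_real x : f x x = (q x)%:C.
Proof. by rewrite /q; have := dotxx_Im x; case: (f x x) => u v /= ->. Qed.

Lemma ReDot_ge0 x : 0 <= q x.
Proof. by rewrite -ler0c -dotxx_real dnorm_ge0. Qed.

Lemma ReDot_eq0 x : q x = 0 -> x = 0.
Proof. by move=> q0; apply/eqP; rewrite -(dnorm_eq0 f) dotxx_real q0. Qed.

Lemma ReDotC x y : b x y = b y x.
Proof. by rewrite /b dot_hermC ReJ. Qed.

Lemma ReDotD x y : q (x + y) = q x + q y + 2 * b x y.
Proof.
rewrite /q linearDl/= !linearDr/= !ReD -!/(b _ _) (ReDotC y x).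
by ring.
Qed.

Lemma ReDotZ (a : R[i]) x : q (a *: x) = reC (`|a| ^+ 2) * q x :> R.
Proof. by rewrite /q dnormZ ReM dotxx_Im mulr0 subr0.
Qed.

Lemma ReDotZr (t : R) x y : b x (t%:C *: y) = t * b x y.
Proof. by rewrite /b linearZr_LR/= ReM ReJ ImJ/= oppr0 mul0r subr0. Qed.

Lemma ReDotN x : q (- x) = q x.
Proof. by rewrite /q linearNl linearNr opprK. Qed.

Lemma ReDotNr x y : b x (- y) = - b x y.
Proof. by rewrite /b linearNr ReN. Qed.

Lemma ReDot_CS x y : b x y ^+ 2 <= q x * q y.
Proof.
have [qy0|qy0] := eqVneq (q y) 0.
  by rewrite qy0 mulr0 (ReDot_eq0 qy0) /b linear0r /reC/= expr0n.
have qy : 0 < q y by rewrite lt_def qy0 ReDot_ge0.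
have := ReDot_ge0 ((- (b x y / q y))%:C *: y + x).
rewrite ReDotD (ReDotC _ x) ReDotZr ReDotZ.
rewrite reC_norm2 /reC /imC/= expr0n/= addr0.
rewrite -(pmulr_rge0 _ qy).
rewrite [X in 0 <= X -> _](_ : _ = q x * q y - b x y ^+ 2); last by field.
by rewrite subr_ge0.
Qed.

Lemma sqrt_ReDotD x y : Num.sqrt (q (x + y)) <= Num.sqrt (q x) + Num.sqrt (q y).
Proof.
rewrite -[leRHS]ger0_norm ?addr_ge0 ?sqrtr_ge0// -sqrtr_sqr.
rewrite ler_sqrt ?sqr_ge0// sqrrD !sqr_sqrtr ?ReDot_ge0// ReDotD.
have : b x y <= Num.sqrt (q x) * Num.sqrt (q y).
  rewrite (le_trans (ler_norm _))// -sqrtrM ?ReDot_ge0// -sqrtr_sqr.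
  by rewrite ler_wsqrtr// ReDot_CS.
by lra.
Qed.

End DotRe.

Definition hnorm (R : realType) (V : normedModType R[i]) (x : V) : R := reC `|x|.

Section HilbertNorm.
Variables (R : realType) (H : hilbertType R).
Implicit Types (x y : H).

Lemma normr_hnorm x : `|x| = (hnorm x)%:C.
Proof. by rewrite /hnorm RRe_real// ger0_real. Qed.

Lemma hnormE x : hnorm x = Num.sqrt (reC '[x, x]).
Proof.
rewrite -dotp_normE normr_hnorm -rmorphXn/= sqrtr_sqr ger0_norm//.
by rewrite -ler0c -normr_hnorm.
Qed.

Lemma hnorm_sqr x : hnorm x ^+ 2 = reC '[x, x].
Proof. by rewrite hnormE sqr_sqrtr ?ReDot_ge0. Qed.

Lemma hnorm_continuous : continuous (@hnorm R H).
Proof.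
move=> x; apply/cvgrPdist_lt => e e0; near=> y.
have : `|x - y| < e%:C.
  by near: y; apply: (@cvgr_dist_lt _ _ _ (nbhs x) _ id) => //; rewrite ltcR.
rewrite normr_hnorm ltcR; apply: le_lt_trans.
have hB (u v : H) : hnorm u <= hnorm v + hnorm (u - v).
  by rewrite -[in leLHS](subrK v u) addrC !hnormE sqrt_ReDotD.
have := hB x y; have := hB y x.
have -> : hnorm (y - x) = hnorm (x - y) by rewrite /hnorm distrC.
by move=> h1 h2; rewrite ler_norml; apply/andP; split; lra.
Unshelve. all: by end_near. Qed.

Lemma cvg_reC_dot T (F : set_system T) (f : T -> H) (l x : H) :
  Filter F -> f t @[t --> F] --> l -> reC '[f t, x] @[t --> F] --> reC '[l, x].
Proof.
move=> FF fl.
have E y : reC '[y, x] = 2^-1 * (hnorm (y + x) * hnorm (y + x)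
    - hnorm y * hnorm y - hnorm x * hnorm x) :> R.
  by rewrite -!expr2 !hnorm_sqr ReDotD; field.
rewrite E; under eq_fun do rewrite E.
have cn (g : T -> H) k : g t @[t --> F] --> k ->
    hnorm (g t) @[t --> F] --> hnorm k.
  by move=> gk; apply: continuous_cvg => //; exact: hnorm_continuous.
apply: cvgMr; apply: cvgB; last exact: cvg_cst.
apply: cvgB; apply: cvgM; apply: cn => //;
  by apply: cvgD => //; exact: cvg_cst.
Qed.

End HilbertNorm.

Section SquareSums.
Variable R : realType.
Implicit Types (u v : nat * nat -> R).

(* All the double series below converge absolutely, so summing over the squares
   [0, N[ x [0, N[ gives their unordered sum. *)
Definition psum u (N : nat) : R := \sum_(i < N) \sum_(j < N) u (i : nat, j : nat).

Lemma psumD u v N : psum (fun I => u I + v I) N = psum u N + psum v N.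
Proof.
by rewrite /psum -big_split/=; apply: eq_bigr => i _; rewrite big_split.
Qed.

Lemma psumZ (c : R) u N : psum (fun I => c * u I) N = c * psum u N.
Proof.
by rewrite /psum mulr_sumr; apply: eq_bigr => i _; rewrite mulr_sumr.
Qed.

Lemma le_psum u v N : (forall I, u I <= v I) -> psum u N <= psum v N.
Proof. by move=> uv; apply: ler_sum => i _; apply: ler_sum. Qed.

Lemma psum_ge0 u N : (forall I, 0 <= u I) -> 0 <= psum u N.
Proof. by move=> u0; apply: sumr_ge0 => i _; apply: sumr_ge0. Qed.

Lemma psum_nd u : (forall I, 0 <= u I) -> nondecreasing_seq (psum u).
Proof.
move=> u0; apply/nondecreasing_seqP => n; rewrite /psum big_ord_recr/=.
apply: ler_wpDr; first exact: sumr_ge0.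
by apply: ler_sum => i _; rewrite big_ord_recr/= lerDl.
Qed.

Lemma psum_ge u (I : nat * nat) N : (forall J, 0 <= u J) ->
  (I.1 < N)%N -> (I.2 < N)%N -> u I <= psum u N.
Proof.
move=> u0 h1 h2; rewrite /psum (bigD1 (Ordinal h1))//= (bigD1 (Ordinal h2))//=.
rewrite -surjective_pairing -addrA lerDl addr_ge0//.
  by apply: sumr_ge0.
by apply: sumr_ge0 => i _; apply: sumr_ge0.
Qed.

Lemma cvg_psum u M : (forall I, 0 <= u I) -> (forall N, psum u N <= M) ->
  cvgn (psum u).
Proof.
move=> u0 uM; apply: nondecreasing_is_cvgn; first exact: psum_nd.
by exists M => _ [n _ <-].
Qed.

End SquareSums.

Section Ell2.
Variables (R : realType) (H : hilbertType R).
Implicit Types (f g : nat * nat -> H).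

Let sqn (x : H) : R := reC '[x, x].

Definition square_summable : {pred nat * nat -> H} :=
  fun f => `[< exists M : R, forall N, psum (fun I => reC '[f I, f I]) N <= M >].

Lemma square_summable_closed : submod_closed square_summable.
Proof.
split.
  apply/asboolP; exists 0 => N; rewrite /psum big1// => i _; rewrite big1// => j _.
  by rewrite linear0r.
move=> a f g /asboolP[M fM] /asboolP[M' gM]; apply/asboolP.
pose c : R := reC (`|a| ^+ 2).
have c0 : 0 <= c.
  by rewrite /c reC_norm2 addr_ge0 ?sqr_ge0.
exists (2 * (c * M + M')) => N.
rewrite (@le_trans _ _ (2 * (c * psum (fun I => sqn (f I)) N
    + psum (fun I => sqn (g I)) N)))//; last first.
  by rewrite ler_wpM2l// lerD// ler_wpM2l.
rewrite -psumZ -psumD -psumZ; apply: le_psum => I.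
have -> : (a *: f + g) I = a *: f I + g I by [].
have := ReDot_ge0 dotp (a *: f I - g I).
rewrite !ReDotD ReDotN ReDotNr ReDotZ -/c -!/(sqn _).
set X := reC _.
lra.
Qed.

HB.instance Definition _ := GRing.isSubmodClosed.Build _ _ square_summable
  square_summable_closed.

Record ell2 := Ell2 {
  ell2_val :> nat * nat -> H;
  ell2_valP : ell2_val \in square_summable
}.

HB.instance Definition _ := [isSub for ell2_val].
HB.instance Definition _ := [Choice of ell2 by <:].
HB.instance Definition _ := [SubChoice_isSubLmodule of ell2 by <:].


Definition ell2_dot (f g : ell2) : R[i] :=
  limn (psum (fun I => reC '[f I, g I])) +i* limn (psum (fun I => imC '[f I, g I])).

Lemma ell2_cvg_sqn (f : ell2) : cvgn (psum (fun I => reC '[f I, f I])).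
Proof.
have /asboolP[M fM] := ell2_valP f.
by apply: cvg_psum fM => I; exact: ReDot_ge0.
Qed.

Lemma ell2_cvg_Re (f g : ell2) : cvgn (psum (fun I => reC '[f I, g I])).
Proof.
rewrite (_ : psum _ = fun N => 2^-1 * (psum (fun I => reC '[(f + g) I, (f + g) I]) N
   + -1 * (psum (fun I => reC '[f I, f I]) N + psum (fun I => reC '[g I, g I]) N))).
  apply: is_cvgMr; apply: is_cvgD; first exact: ell2_cvg_sqn.
  by apply: is_cvgMr; apply: is_cvgD; exact: ell2_cvg_sqn.
apply/funext => N; rewrite -psumD -psumZ -psumD -psumZ.
congr psum; apply/funext => I.
rewrite (_ : (f + g) I = f I + g I)// ReDotD.
by field.
Qed.

Lemma ell2_cvg_Im (f g : ell2) : cvgn (psum (fun I => imC '[f I, g I])).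
Proof.
rewrite (_ : psum _ =
  fun N => -1 * psum (fun I => reC '[('i%C *: f : ell2) I, g I]) N).
  by apply: is_cvgMr; exact: ell2_cvg_Re.
apply/funext => N; rewrite -psumZ; congr psum; apply/funext => I.
rewrite (_ : ('i%C *: f : ell2) I = 'i%C *: f I)// linearZl_LR/=.
by rewrite ReM /imC /reC/= mul0r mul1r sub0r mulN1r opprK.
Qed.

Lemma ell2_dotC (f g : ell2) : ell2_dot f g = Num.conj (ell2_dot g f).
Proof.
apply/eqP; rewrite eq_complex/=; apply/andP; split; apply/eqP.
  by congr (limn (psum _)); apply/funext => I; rewrite ReDotC.
apply: cvg_lim => //; rewrite -mulN1r.
rewrite (_ : psum _ = fun N => -1 * psum (fun I => imC '[g I, f I]) N).
  by apply: cvgMr; exact: ell2_cvg_Im.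
apply/funext => N; rewrite -psumZ; congr psum; apply/funext => I.
by rewrite mulN1r dot_hermC ImJ.
Qed.

Let ell2_dotC_subproof (f g : ell2) :
  ell2_dot f g = (-1) ^+ false * Num.conj (ell2_dot g f).
Proof. by rewrite expr0 mul1r ell2_dotC. Qed.

Lemma ell2_dot_linearl (g : ell2) : linear_for *%R (ell2_dot^~ g).
Proof.
move=> a f f'; have e I : (a *: ell2_val f + ell2_val f') I = a *: f I + f' I by [].
apply/eqP; rewrite eq_complex; apply/andP; split; apply/eqP.
  apply: cvg_lim => //; rewrite -!/(reC _) ReD ReM/=.
  rewrite (_ : psum _ = fun N => reC a * psum (fun I => reC '[f I, g I]) N
    - imC a * psum (fun I => imC '[f I, g I]) N
    + psum (fun I => reC '[f' I, g I]) N).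
    by apply: cvgD; [apply: cvgB; apply: cvgMr|];
      [exact: ell2_cvg_Re|exact: ell2_cvg_Im|exact: ell2_cvg_Re].
  apply/funext => N; rewrite -mulNr -!psumZ -!psumD; congr psum; apply/funext => I.
  rewrite e linearPl/=.
  by rewrite ReD ReM mulNr.
apply: cvg_lim => //; rewrite -!/(imC _) ImD ImM/=.
rewrite (_ : psum _ = fun N => reC a * psum (fun I => imC '[f I, g I]) N
  + imC a * psum (fun I => reC '[f I, g I]) N
  + psum (fun I => imC '[f' I, g I]) N).
  by apply: cvgD; [apply: cvgD; apply: cvgMr|];
    [exact: ell2_cvg_Im|exact: ell2_cvg_Re|exact: ell2_cvg_Im].
apply/funext => N; rewrite -!psumZ -!psumD; congr psum; apply/funext => I.
rewrite e linearPl/=.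
by rewrite ImD ImM.
Qed.

Lemma ell2_dot_linearr (f : ell2) : linear_for (Num.conj \; *%R) (ell2_dot f).
Proof.
move=> a g g'; rewrite ell2_dotC ell2_dot_linearl rmorphD rmorphM/=.
by rewrite -!ell2_dotC.
Qed.

Lemma ell2_dot_gt0 (f : ell2) : f != 0 -> 0 < ell2_dot f f.
Proof.
move=> f0; rewrite ltcE/=; apply/andP; split.
  apply/eqP/cvg_lim => //; rewrite (_ : psum _ = cst 0); first exact: cvg_cst.
  apply/funext => N; rewrite /psum big1// => i _; rewrite big1// => j _.
  exact: dotxx_Im.
have [I fI] : exists I, f I != 0.
  apply/not_existsP => f0'; move/eqP: f0; apply; apply/val_inj/funext => I.
  by apply/eqP; have /negP := f0' I; rewrite negbK.
have fI0 : 0 < reC '[f I, f I].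
  by rewrite lt_def ReDot_ge0 andbT; apply: contra_neq fI => /ReDot_eq0.
pose N := (maxn I.1 I.2).+1.
apply: (lt_le_trans fI0).
apply: le_trans (nondecreasing_cvgn_le _ (@ell2_cvg_sqn f) N); last first.
  by apply: psum_nd => J; exact: ReDot_ge0.
apply: (@psum_ge _ (fun J => reC '[f J, f J])) => [J||].
- exact: ReDot_ge0.
- by rewrite ltnS leq_maxl.
- by rewrite ltnS leq_maxr.
Qed.

HB.instance Definition _ := @bilinear_isBilinear.Build R[i] ell2 ell2 R[i]
  *%R (Num.conj \; *%R) ell2_dot (ell2_dot_linearl, ell2_dot_linearr).


HB.instance Definition _ := @isHermitianSesquilinear.Build R[i] ell2 false
  Num.conj ell2_dot ell2_dotC_subproof.
HB.instance Definition _ := @isDotProduct.Build R[i] ell2 ell2_dot ell2_dot_gt0.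

Let ell2_norm (f : ell2) : R[i] := (Num.sqrt (reC (ell2_dot f f)))%:C.

Let ell2_normD (f g : ell2) : ell2_norm (f + g) <= ell2_norm f + ell2_norm g.
Proof. by rewrite /ell2_norm -rmorphD lecR; exact: sqrt_ReDotD. Qed.

Let ell2_normZ (a : R[i]) (f : ell2) : ell2_norm (a *: f) = `|a| * ell2_norm f.
Proof.
rewrite /ell2_norm ReDotZ sqrtrM ?reC_norm2 ?addr_ge0 ?sqr_ge0// rmorphM/=.
by rewrite normc_def.
Qed.

Let ell2_norm0 (f : ell2) : ell2_norm f = 0 -> f = 0.
Proof.
move=> /complexI/eqP; rewrite sqrtr_eq0 => f0; apply: (ReDot_eq0 (f := ell2_dot)).
by apply/eqP; rewrite eq_le f0 ReDot_ge0.
Qed.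

HB.instance Definition _ := @Lmodule_isNormed.Build R[i] ell2 ell2_norm
  ell2_normD ell2_normZ ell2_norm0.


Let cvg_psumB (F : set_system ell2) (x : ell2) (l : nat * nat -> H) N :
  Filter F -> (forall I, (f : ell2) I @[f --> F] --> l I) ->
  psum (fun I => reC '[(x - f) I, (x - f) I]) N @[f --> F] -->
  psum (fun I => reC '[x I - l I, x I - l I]) N.
Proof.
move=> FF Fl; rewrite /psum; apply: cvg_big => [|i _].
  exact: add_continuous.
apply: cvg_big => [|j _]; first exact: add_continuous.
have sq z : reC '[z, z] = hnorm z * hnorm z :> R by rewrite -expr2 hnorm_sqr.
rewrite sq.
under eq_fun do rewrite sq.
apply: cvgM; apply: continuous_cvg; try exact: hnorm_continuous;
  by apply: cvgB; [exact: cvg_cst|exact: Fl].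
Qed.

Let le_psum_ell2 (f : ell2) N :
  psum (fun I => reC '[f I, f I]) N <= reC (ell2_dot f f).
Proof.
apply: (nondecreasing_cvgn_le _ (@ell2_cvg_sqn f) N).
by apply: psum_nd => J; exact: ReDot_ge0.
Qed.

Let ell2_coord_le (f : ell2) I : `|f I| <= `|f|.
Proof.
rewrite normr_hnorm hnormE lecR ler_wsqrtr//.
apply: le_trans (le_psum_ell2 f (maxn I.1 I.2).+1).
apply: (@psum_ge _ (fun J => reC '[f J, f J])) => [J||].
- exact: ReDot_ge0.
- by rewrite ltnS leq_maxl.
- by rewrite ltnS leq_maxr.
Qed.

Let ell2_dot_norm (f : ell2) : `|f| ^+ 2 = ell2_dot f f.
Proof.
rewrite [RHS]dotxx_real -rmorphXn sqr_sqrtr; last exact: ReDot_ge0.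
by [].
Qed.

Let ell2_complete (F : set_system ell2) : ProperFilter F -> cauchy F -> cvg F.
Proof.
move=> FF /cauchy_ballP Fc.
have Fl I : cvg ((f : ell2) I @[f --> F]).
  apply: cauchy_cvg; apply/cauchy_ballP => e e0.
  have := Fc _ e0; rewrite !near_simpl => -[[A B]/= [FA FB] AB].
  exists ((fun f : ell2 => f I) @` A, (fun f : ell2 => f I) @` B) => /=.
    split; rewrite /nbhs/=.
      by apply: filterS FA => f Af; exists f.
    by apply: filterS FB => f Bf; exists f.
  move=> [_ _] [/= [f Af <-] [g Bg <-]].
  have := AB (f, g) (conj Af Bg); rewrite -!ball_normE/=.
  by apply: le_lt_trans; exact: (ell2_coord_le (f - g)).
pose l I := lim ((f : ell2) I @[f --> F]).
have fF : Filter F by apply: filter_filter.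
have key (e : R) : 0 < e -> \forall x \near F, forall N,
    psum (fun I => reC '[(x : ell2) I - l I, x I - l I]) N <= e ^+ 2.
  move=> e0; have e0c : 0 < e%:C :> R[i] by rewrite ltcR.
  have [[A B]/= [FA FB] AB] := Fc _ e0c.
  apply: filterS FA => x Ax N.
  have cF := @cvg_psumB F x l N fF Fl.
  apply: (cvgr_to_le cF).
  apply: filterS FB => y By.
  have := AB (x, y) (conj Ax By); rewrite -ball_normE/= ltcR => /ltW xy.
  apply: (le_trans (le_psum_ell2 (x - y) N)).
  rewrite -[leLHS]sqr_sqrtr ?ReDot_ge0//.
  by rewrite ler_sqr ?nnegrE ?sqrtr_ge0// ltW.
have lP : l \in square_summable.
  have [x xP] := filter_ex (key _ ltr01).
  have -> : l = ell2_val x - (fun I => x I - l I).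
    by apply/funext => I; rewrite !fctE subKr.
  apply: rpredB; first exact: ell2_valP.
  by apply/asboolP; exists (1 ^+ 2).
apply/cvg_ex; exists (Ell2 lP).
apply/cvgrPdist_le => e e0.
have [r [r0 er]] : exists r : R, 0 < r /\ e = r%:C.
  move: e0; case: e => r i; rewrite ltcE/= => /andP[/eqP -> r0].
  by exists r.
apply: filterS (key r r0) => x xr; rewrite er distrC lecR.
rewrite -[leRHS](ger0_norm (ltW r0)) -sqrtr_sqr ler_wsqrtr//.
apply: limr_le; first exact: ell2_cvg_sqn.
by apply: nearW => N; exact: xr.
Qed.

HB.instance Definition _ := Uniform_isComplete.Build ell2 ell2_complete.
HB.instance Definition _ :=
  @NormedModule_isInnerProduct.Build R ell2 ell2_dot ell2_dot_norm.

Let ell2_single_fun (m n : nat) (h : H) : nat * nat -> H :=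
  fun I => if I == (m, n) then h else 0.

Let ell2_single_subproof m n h : ell2_single_fun m n h \in square_summable.
Proof.
apply/asboolP; exists (reC '[h, h]) => N.
have z (I : nat * nat) : I != (m, n) ->
    reC '[ell2_single_fun m n h I, ell2_single_fun m n h I] = 0 :> R.
  by move=> /negPf Imn; rewrite /ell2_single_fun Imn linear0r.
have le (I : nat * nat) :
    reC '[ell2_single_fun m n h I, ell2_single_fun m n h I] <= reC '[h, h] :> R.
  by rewrite /ell2_single_fun; case: ifP => // _; rewrite linear0r ReDot_ge0.
rewrite /psum; have [mN|Nm] := ltnP m N; last first.
  rewrite big1 ?ReDot_ge0// => i _; rewrite big1// => j _; apply: z.
  by apply: contraTneq Nm => -[<- _]; rewrite -ltnNge.
rewrite (bigD1 (Ordinal mN))//= [X in _ + X]big1 ?addr0; last first.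
  move=> i im; rewrite big1// => j _; apply: z.
  by apply: contra_neq im => -[im _]; apply/val_inj.
have [nN|Nn] := ltnP n N; last first.
  rewrite big1 ?ReDot_ge0// => j _; apply: z.
  by apply: contraTneq Nn => -[<-]; rewrite -ltnNge.
rewrite (bigD1 (Ordinal nN))//= [X in _ + X]big1 ?addr0// => j jn; apply: z.
by apply: contra_neq jn => -[jn]; apply/val_inj.
Qed.

(* e_{m,n} (x) h *)
Definition ell2_single (m n : nat) (h : H) : ell2 :=
  Ell2 (ell2_single_subproof m n h).

End Ell2.

Definition separable_space (T : topologicalType) :=
  exists S : set T, countable S /\ dense S.

Section Operators.
Variable R : realType.

(* The unique B with <A x, y> = <x, B y>, which exists for A linear and bounded
   by the Riesz representation theorem; when there is no such B, the value is an
   unspecified function. *)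
Definition adjoint (H K : hilbertType R) (A : H -> K) : K -> H :=
  get [set B : K -> H | forall x y, '[A x, y] = '[x, B y]].

(* The supremum is taken over the closed unit ball, so that it is not over an
   empty set when H is the zero space. *)
Definition opnorm (H K : hilbertType R) (A : H -> K) : R :=
  sup [set hnorm (A x) | x in [set x | hnorm x <= 1]].

(* 0 <= z for z : R[i] also says that z is real. *)
Definition positive_op (H : hilbertType R) (A : H -> H) :=
  forall x, 0 <= '[A x, x].

Definition invertible_op (H : hilbertType R) (A : {linear H -> H}) :=
  exists B : {linear H -> H}, [/\ continuous B, cancel A B & cancel B A].

Definition orthogonal_projection (H : hilbertType R) (P : {linear H -> H}) :=
  [/\ continuous P, forall x, P (P x) = P x & forall x y, '[P x, y] = '[x, P y]].

Definition toral_2isometry (K : hilbertType R) (T1 T2 : {linear K -> K}) :=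
  let defect (S T : K -> K) (x : K) :=
    x - adjoint S (S x) - adjoint T (T x) + adjoint T (adjoint S (S (T x))) in
  [/\ continuous T1, continuous T2, forall x, T1 (T2 x) = T2 (T1 x) &
      forall x, [/\ defect T1 T1 x = 0, defect T1 T2 x = 0,
                    defect T2 T1 x = 0 & defect T2 T2 x = 0]].

End Operators.

Section WeightedShifts.
Variables (R : realType) (H : hilbertType R).

Definition weighted_shift (W1 W2 : nat -> nat -> {linear H -> H})
    (T1 T2 : {linear ell2 H -> ell2 H}) :=
  forall m n h,
    T1 (ell2_single m n h) = ell2_single m.+1 n (W1 m n h) /\
    T2 (ell2_single m n h) = ell2_single m n.+1 (W2 m n h).

(* weight_prod0 W2 n = W2_{0,n-1} ... W2_{0,0} and
   weight_prod W1 W2 m n = W1_{m-1,n} ... W1_{0,n} W2_{0,n-1} ... W2_{0,0} *)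
Fixpoint weight_prod0 (W2 : nat -> nat -> {linear H -> H}) (n : nat) : H -> H :=
  if n is n'.+1 then W2 0%N n' \o weight_prod0 W2 n' else id.

Fixpoint weight_prod (W1 W2 : nat -> nat -> {linear H -> H}) (m n : nat) : H -> H :=
  if m is m'.+1 then W1 m' n \o weight_prod W1 W2 m' n else weight_prod0 W2 n.

Definition ell2_IWP (W1 W2 : nat -> nat -> {linear H -> H})
    (T1 T2 : {linear ell2 H -> ell2 H}) :=
  [/\ weighted_shift W1 W2 T1 T2,
      forall m n, continuous (W1 m n) /\ continuous (W2 m n),
      forall m n, invertible_op (W1 m n) /\ invertible_op (W2 m n) &
      forall m n, positive_op (weight_prod W1 W2 m n)].

End WeightedShifts.

(* Only the values on measurable sets are meaningful. *)
Record projection_measure d (T : measurableType d) (R : realType)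
    (H : hilbertType R) := ProjectionMeasure {
  pm_val :> set T -> {linear H -> H};
  pm_proj : forall A, measurable A -> orthogonal_projection (pm_val A);
  pm_set0 : forall x, pm_val set0 x = 0;
  pm_setT : forall x, pm_val setT x = x;
  pm_setI : forall A B, measurable A -> measurable B ->
    forall x, pm_val (A `&` B) x = pm_val A (pm_val B x);
  (* countable additivity in the strong operator topology *)
  pm_sigma_additive : forall F : nat -> set T,
    (forall n, measurable (F n)) -> trivIset setT F ->
    forall x, \sum_(0 <= k < n) pm_val (F k) x @[n --> \oo] -->
      pm_val (\bigcup_k F k) x
}.

Section SpectralIntegral.
Context d (T : measurableType d) (R : realType) (H : hilbertType R).
Variable E : projection_measure T H.

(* A |-> ||E(A) x||^2, which is A |-> <E(A) x, x> on measurable sets, and is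
   nonnegative on all sets *)
Definition scalar_measure (x : H) (A : set T) : \bar R :=
  (hnorm (E A x) ^+ 2)%:E.

Section ScalarMeasure.
Variable x : H.

Let scalar_measureE A : measurable A ->
  scalar_measure x A = (reC '[E A x, x])%:E.
Proof.
move=> /(pm_proj E)[_ EE Esym].
by rewrite /scalar_measure hnorm_sqr -Esym EE.
Qed.

Let scalar_measure0 : scalar_measure x set0 = 0%E.
Proof. by rewrite /scalar_measure pm_set0 hnorm_sqr linear0r. Qed.

Let scalar_measure_ge0 A : (0 <= scalar_measure x A)%E.
Proof. by rewrite lee_fin sqr_ge0. Qed.

Let scalar_measure_sigma : semi_sigma_additive (scalar_measure x).
Proof.
move=> F mF tF mUF; rewrite scalar_measureE//.
rewrite (_ : (fun n => _) =
  (fun n => (reC '[\sum_(0 <= k < n) E (F k) x, x])%:E)).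
  apply: cvg_EFin; first exact: nearW.
  apply: cvg_reC_dot; exact: pm_sigma_additive.
apply/funext => n; rewrite linear_sumlz/=.
rewrite [reC _](_ : _ = \sum_(0 <= i < n) reC '[E (F i) x, x]); last first.
  by elim/big_rec2 : _ => // i u v _ <-; rewrite ReD.
by rewrite -sumEFin; apply: eq_bigr => i _; rewrite scalar_measureE.
Qed.

HB.instance Definition _ := isMeasure.Build _ _ _ (scalar_measure x)
  scalar_measure0 scalar_measure_ge0 scalar_measure_sigma.

End ScalarMeasure.

(* A is the integral of f over D with respect to E, in the weak sense
   <A x, x> = int_D f(t) d<E(t) x, x>: by polarization in a complex space, the
   quadratic forms determine A and the sesquilinear form <A x, y>. *)
Definition spectral_integral (D : set T) (f : T -> R) (A : H -> H) :=
  forall x, (scalar_measure x).-integrable D (EFin \o f) /\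
    '[A x, x] = (\int[scalar_measure x]_(t in D) f t)%:C.

End SpectralIntegral.

(* R * R carries the product of the Borel sigma-algebras, i.e., the Borel
   sigma-algebra of the plane. *)
Definition joint_spectral_measure (R : realType) (H : hilbertType R)
    (C1 C2 : H -> H) (E : projection_measure (R * R)%type H) :=
  spectral_integral E setT fst C1 /\ spectral_integral E setT snd C2.

(* Main.v *)
Require Import Defs.
From HB Require Import structures.
From mathcomp Require Import all_boot all_order all_algebra complex.
From mathcomp Require Import all_classical all_reals all_analysis.
From mathcomp Require Import measurable_realfun ring lra.

Set Implicit Arguments.
Unset Strict Implicit.
Unset Printing Implicit Defensive.

Import Order.TTheory GRing.Theory Num.Theory.
Import numFieldNormedType.Exports.

Local Open Scope classical_set_scope.
Local Open Scope ring_scope.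

(** Write P_{m,n} for the weight products and C1, C2 for the two initial weights.

    Evaluated at the vectors e_{m,n} tensor h, the defect identities of a toral
    2-isometry say that all second differences of (m, n) |-> |P_{m,n} h|^2
    vanish, so that
      |P_{m,n} h|^2 = |h|^2 + m (|C1 h|^2 - |h|^2) + n (|C2 h|^2 - |h|^2)
    ([weight_prod_affine]). A positive operator is symmetric, hence P_{m,n} is a
    positive square root of 1 + m (C1^2 - 1) + n (C2^2 - 1). The left-hand side
    stays nonnegative for all m and n, which forces |C1 h|, |C2 h| >= |h|; with
    positivity and invertibility this gives 1 <= C1 <= a1 and 1 <= C2 <= a2 as
    operators, and E is carried by the rectangle ([rectangle_full]).

    It remains to take square roots and quotients under the spectral integral:
    P_{m,n} is the integral of the square root of the growth function
    1 + m (x^2 - 1) + n (y^2 - 1), and W^(1)_{m,n} = P_{m+1,n} P_{m,n}^{-1}, while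
    the commutation of T1 and T2 gives W^(2)_{m,n} = P_{m,n+1} P_{m,n}^{-1}.

    The functional calculus is built on the relation [represents], between a
    bounded function f and a bounded operator A that commutes with E: for every e > 0
    there is a finite measurable partition such that, on each cell, f varies by
    at most e and A differs from multiplication by a value of f by at most e in
    norm, on the range of the projection of the cell. This relation passes to
    sums, products and, when f >= 1, inverses by elementary estimates, and for a bounded
    measurable f it implies the integral formula ([represents_integral]).

    For square roots the estimate is easy, because P + a expands norms by a when
    P >= 0 ([represents_sqrt]); what needs an argument is that P commutes with E
    as soon as P^2 does ([sqrt_commutes]). This follows from the uniqueness of
    positive square roots ([positive_sqrt_unique]), applied to P and to its
    conjugate by the reflection 2 E(S) - 1, so that no square root has to be
    constructed beforehand. *)

(** * The real part of the inner product *)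

Section RealInnerProduct.
Variables (R : realType) (H : hilbertType R).
Implicit Types (x y z : H) (c : R).

(** The real part is symmetric and bilinear, which keeps all estimates in [R]. *)
Definition rdot x y : R := reC '[x, y].
Definition rscale c x : H := (c%:C)%C *: x.
Definition irot x : H := 'i%C *: x.

Lemma rscaleBr c x y : rscale c (x - y) = rscale c x - rscale c y.
Proof. exact: scalerBr. Qed.

Lemma rscaleDl a c x : rscale (a + c) x = rscale a x + rscale c x.
Proof. by rewrite /rscale rmorphD scalerDl. Qed.

Lemma rscaleA a c x : rscale a (rscale c x) = rscale (a * c) x.
Proof. by rewrite /rscale scalerA -rmorphM. Qed.

Lemma rscale1 x : rscale 1 x = x.
Proof. exact: scale1r. Qed.

Lemma rdotC x y : rdot x y = rdot y x.
Proof. exact: ReDotC. Qed.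

Lemma rdotDl x y z : rdot (x + y) z = rdot x z + rdot y z.
Proof. by rewrite /rdot linearDl Defs.ReD. Qed.

Lemma rdotDr x y z : rdot x (y + z) = rdot x y + rdot x z.
Proof. by rewrite rdotC rdotDl !(rdotC x). Qed.

Lemma rdotZl c x y : rdot (rscale c x) y = c * rdot x y.
Proof. by rewrite rdotC /rdot ReDotZr ReDotC. Qed.

Lemma rdotZr c x y : rdot x (rscale c y) = c * rdot x y.
Proof. by rewrite rdotC rdotZl rdotC. Qed.

Lemma rdotNl x y : rdot (- x) y = - rdot x y.
Proof. by rewrite /rdot linearNl Defs.ReN. Qed.

Lemma rdotNr x y : rdot x (- y) = - rdot x y.
Proof. by rewrite rdotC rdotNl rdotC. Qed.

Lemma rdotBl x y z : rdot (x - y) z = rdot x z - rdot y z.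
Proof. by rewrite rdotDl rdotNl. Qed.

Lemma rdotBr x y z : rdot x (y - z) = rdot x y - rdot x z.
Proof. by rewrite rdotDr rdotNr. Qed.

Lemma rdot0l x : rdot 0 x = 0.
Proof. by rewrite -(subrr x) rdotBl subrr. Qed.

Lemma rdot0r x : rdot x 0 = 0.
Proof. by rewrite rdotC rdot0l. Qed.

Lemma rdot_suml I (r : seq I) (P : pred I) (F : I -> H) y :
  rdot (\sum_(i <- r | P i) F i) y = \sum_(i <- r | P i) rdot (F i) y.
Proof. by elim/big_rec2 : _ => [|i u v _ <-]; rewrite ?rdot0l ?rdotDl. Qed.

Lemma rdot_irot x y : rdot x (irot y) = imC '[x, y].
Proof.
have -> : rdot x (irot y) = reC (Num.conj 'i%C * '[x, y]).
  by rewrite /rdot /irot linearZr_LR.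
rewrite Defs.ReM Defs.ReJ Defs.ImJ -[RHS]mul1r.
by rewrite /reC /imC/= mul0r sub0r mulN1r opprK mul1r.
Qed.

Lemma rdot_irotl x y : rdot (irot x) y = - rdot x (irot y).
Proof. by rewrite rdotC !rdot_irot dot_hermC Defs.ImJ. Qed.

Lemma irotK x : irot (irot x) = - x.
Proof. by rewrite /irot scalerA -expr2 sqr_i scaleN1r. Qed.

Lemma rdotxx x : rdot x x = hnorm x ^+ 2.
Proof. by rewrite hnorm_sqr. Qed.

Lemma hnorm_ge0 x : 0 <= hnorm x.
Proof. by rewrite hnormE sqrtr_ge0. Qed.

Lemma hnorm_sq_le x c : 0 <= c -> (hnorm x <= c) = (rdot x x <= c ^+ 2).
Proof. by move=> c0; rewrite rdotxx ler_sqr ?nnegrE ?hnorm_ge0. Qed.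

Lemma hnorm0_eq0 x : hnorm x = 0 -> x = 0.
Proof.
by move=> x0; apply: (ReDot_eq0 (f := @dotp R H)); rewrite -hnorm_sqr x0 expr0n.
Qed.

Lemma hnorm0 : hnorm (0 : H) = 0.
Proof. by rewrite hnormE -/(rdot 0 0) rdot0l sqrtr0. Qed.

Lemma hnorm_add_le x y : hnorm (x + y) <= hnorm x + hnorm y.
Proof. by rewrite !hnormE sqrt_ReDotD. Qed.

Lemma hnorm_opp x : hnorm (- x) = hnorm x.
Proof. by rewrite !hnormE ReDotN. Qed.

Lemma hnorm_rscale c x : hnorm (rscale c x) = `|c| * hnorm x.
Proof.
apply/eqP; rewrite -(@eqrXn2 _ 2)// ?mulr_ge0 ?hnorm_ge0//.
by rewrite exprMn -!rdotxx rdotZl rdotZr mulrA -expr2 -real_normK ?num_real.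
Qed.

Lemma rdot_CS x y : `|rdot x y| <= hnorm x * hnorm y.
Proof.
rewrite -(@ler_pXn2r _ 2)// ?nnegrE ?mulr_ge0 ?hnorm_ge0//.
by rewrite exprMn -!rdotxx real_normK ?num_real// ReDot_CS.
Qed.

Lemma rdot_inj x y : (forall z, rdot x z = rdot y z) -> x = y.
Proof.
move=> xy; apply/eqP; rewrite -subr_eq0; apply/eqP/hnorm0_eq0/eqP.
by rewrite -(@eqrXn2 _ 2)// ?hnorm_ge0// expr0n -rdotxx rdotBl xy subrr.
Qed.

End RealInnerProduct.

(** * Symmetric, positive and bounded operators *)

(** The real part of the form sees the whole complex form, through [irot]. *)
Lemma rdot_eq_dot (R : realType) (H K : hilbertType R) (x y : H) (z w : K) :
  rdot x y = rdot z w -> rdot x (irot y) = rdot z (irot w) -> '[x, y] = '[z, w].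
Proof.
rewrite !rdot_irot => re im; apply/eqP; rewrite eq_complex.
by rewrite -!/(reC _) -!/(imC _) -!/(rdot _ _) re im !eqxx.
Qed.

Section Operators.
Variables (R : realType) (H : hilbertType R).
Implicit Types (A B : {linear H -> H}) (x y : H) (c : R).

Lemma lin_rscale (K : hilbertType R) (A : {linear H -> K}) c x :
  A (rscale c x) = rscale c (A x).
Proof. by rewrite /rscale linearZ. Qed.

Lemma lin_irot (K : hilbertType R) (A : {linear H -> K}) x :
  A (irot x) = irot (A x).
Proof. by rewrite /irot linearZ. Qed.

Definition symmetric_op (A : H -> H) := forall x y, rdot (A x) y = rdot x (A y).

(** Polarization: on a complex space a form with real diagonal is Hermitian. *)
Lemma positive_symmetric A : positive_op A -> symmetric_op A.
Proof.
move=> Apos.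
have diag x : rdot (A x) (irot x) = 0.
  by rewrite rdot_irot; apply: ger0_Im; exact: Apos.
have anti x y : rdot (A x) (irot y) = - rdot (A y) (irot x).
  have := diag (x + y); have -> : irot (x + y) = irot x + irot y.
    by rewrite /irot scalerDr.
  rewrite linearD rdotDl !rdotDr !diag; lra.
move=> x y; have := anti x (irot y).
rewrite irotK lin_irot rdotNr rdot_irotl irotK rdotNr opprK => /eqP.
by rewrite eqr_opp => /eqP ->; rewrite rdotC.
Qed.

Lemma positive_op_ge0 A x : positive_op A -> 0 <= rdot (A x) x.
Proof. by move=> /(_ x); rewrite lecE => /andP[]. Qed.

(** The norm of a symmetric operator is its numerical radius: polarize with
    the vector parallel to [T x] that has the length of [x]. *)
Lemma numerical_radius (T : {linear H -> H}) (e : R) :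
  symmetric_op T -> (forall x, `|rdot (T x) x| <= e * rdot x x) ->
  forall x, hnorm (T x) <= e * hnorm x.
Proof.
move=> sT nT x.
have [->|x0] := eqVneq x 0; first by rewrite linear0 hnorm0 mulr0.
have xx : 0 < rdot x x.
  rewrite rdotxx exprn_gt0// lt_def hnorm_ge0 andbT.
  by apply: contra_neq x0 => /hnorm0_eq0.
have e0 : 0 <= e by rewrite -(pmulr_lge0 _ xx) (le_trans _ (nT x)).
have [->|Tx0] := eqVneq (hnorm (T x)) 0; first by rewrite mulr_ge0 ?hnorm_ge0.
have Tx : 0 < hnorm (T x) by rewrite lt_def Tx0 hnorm_ge0.
have pol y : 4 * rdot (T x) y <= 2 * e * (rdot x x + rdot y y).
  have := nT (x + y); have := nT (x - y).
  rewrite !linearD !linearN !ler_norml => /andP[h1 _] /andP[_ h2].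
  move: h1 h2; rewrite !(rdotDl, rdotDr, rdotNl, rdotNr) (rdotC y x).
  rewrite (sT y x) (rdotC y); lra.
have := pol (rscale (hnorm x / hnorm (T x)) (T x)).
rewrite !(rdotZl, rdotZr) !rdotxx.
set a := hnorm x; set b := hnorm (T x) in Tx0 Tx *.
have a0 : 0 < a.
  by rewrite lt_def hnorm_ge0 andbT; apply: contra_neq x0 => /hnorm0_eq0.
have -> : 4 * (a / b * b ^+ 2) = 4 * a * b by field.
have -> : 2 * e * (a ^+ 2 + a / b * (a / b * b ^+ 2)) = 4 * a * (e * a) by field.
by rewrite ler_pM2l// mulr_gt0.
Qed.

Lemma symmetric_eq A B : symmetric_op A -> symmetric_op B ->
  (forall x, rdot (A x) x = rdot (B x) x) -> A =1 B.
Proof.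
move=> sA sB AB x; apply/eqP; rewrite -subr_eq0; apply/eqP/hnorm0_eq0/eqP.
rewrite eq_le hnorm_ge0 andbT -(mul0r (hnorm x)).
apply: (@numerical_radius (A \- B)%R) => [y z|y] /=.
  by rewrite rdotBl rdotBr sA sB.
by rewrite mul0r rdotBl AB subrr normr0.
Qed.

Definition bounded_op (A : H -> H) :=
  exists2 M : R, 0 < M & forall x, hnorm (A x) <= M * hnorm x.

Lemma continuous_bound (K : hilbertType R) (A : {linear H -> K}) :
  continuous A -> exists2 M : R, 0 < M & forall x, hnorm (A x) <= M * hnorm x.
Proof.
move=> /linear_bounded_continuous /linear_boundedP.
case=> M0 [M0r MA].
have MM : M0 < (`|M0| + 1) by rewrite (le_lt_trans (real_ler_norm M0r)) ?ltrDl.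
have [r [r0 rE]] : exists r : R, 0 < r /\ `|M0| + 1 = (r%:C)%C.
  have : 0 < `|M0| + 1 by rewrite ltr_wpDl.
  case: (`|M0| + 1) => r i; rewrite ltcE/= => /andP[/eqP -> r0].
  by exists r.
exists r => // x; have := MA _ MM x.
by rewrite rE !normr_hnorm -rmorphM/= lecR.
Qed.

End Operators.

Section OperatorNorm.
Variables (R : realType) (H : hilbertType R).

Lemma hnorm_le_opnorm (A : {linear H -> H}) x : bounded_op A ->
  hnorm (A x) <= opnorm A * hnorm x.
Proof.
move=> [M M0 bA].
have [->|x0] := eqVneq x 0; first by rewrite linear0 hnorm0 mulr0.
have nx : 0 < hnorm x.
  by rewrite lt_def hnorm_ge0 andbT; apply: contra_neq x0 => /hnorm0_eq0.
have bd : has_ubound [set hnorm (A y) | y in [set y | hnorm y <= 1]].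
  exists M => _ [y /= y1 <-]; apply: le_trans (bA y) _.
  by rewrite ler_piMr// ltW.
have : hnorm (A (rscale (hnorm x)^-1 x)) <= opnorm A.
  apply: ub_le_sup => //; exists (rscale (hnorm x)^-1 x) => //=.
  by rewrite hnorm_rscale ger0_norm ?invr_ge0 ?hnorm_ge0// mulVf ?gt_eqF.
rewrite lin_rscale hnorm_rscale ger0_norm ?invr_ge0 ?hnorm_ge0//.
by rewrite mulrC ler_pdivrMr.
Qed.

(** If P z = x then expanding <P (z - x), z - x> >= 0 bounds <P x, x> below by
    2 |x|^2 - <x, z>, where |z| <= |x|. *)
Lemma positive_expanding_ge1 (P B : {linear H -> H}) :
  positive_op P -> cancel B P ->
  (forall x, rdot x x <= rdot (P x) (P x)) ->
  forall x, rdot x x <= rdot (P x) x.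
Proof.
move=> Ppos BK exp x; have sP := positive_symmetric Ppos.
have := positive_op_ge0 (B x - x) Ppos.
rewrite linearB/= BK !(rdotBl, rdotBr) (sP x (B x)) BK.
have : rdot x (B x) <= rdot x x.
  apply: le_trans (ler_norm _) (le_trans (rdot_CS _ _) _).
  rewrite rdotxx expr2 ler_wpM2l ?hnorm_ge0//.
  by rewrite hnorm_sq_le ?hnorm_ge0// -rdotxx -[in leRHS](BK x).
lra.
Qed.

End OperatorNorm.

(** * Adjoints *)

Section Adjoint.
Variables (R : realType) (H K : hilbertType R).

(** Riesz representation of x |-> <A x, y>: its representing vector minimizes
    |x|^2 - 2 Re <A x, y>. The parallelogram law makes the sublevel sets a
    Cauchy filter, and the first variation at the limit is the representation
    property. *)
Lemma adjoint_vector (A : {linear H -> K}) (y : K) : continuous A ->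
  exists z : H, forall x, '[A x, y] = '[x, z].
Proof.
move=> /continuous_bound[M M0 AM].
pose J (x : H) : R := rdot x x - 2 * rdot (A x) y.
have Jlb : has_lbound (range J).
  exists (- (M * hnorm y) ^+ 2) => _ [x _ <-]; rewrite /J.
  have : rdot (A x) y <= M * hnorm x * hnorm y.
    apply: le_trans (ler_norm _) _; apply: le_trans (rdot_CS _ _) _.
    by rewrite ler_wpM2r ?hnorm_ge0.
  have := sqr_ge0 (hnorm x - M * hnorm y); rewrite rdotxx; lra.
have Jne : range J !=set0 by exists (J 0), 0.
pose m : R := inf (range J).
have mJ x : m <= J x by apply: ge_inf => //; exists x.
have near (e : R) : 0 < e -> exists x, J x < m + e.
  move=> e0; have [_ [x _ <-] xe] := inf_adherent e0 (conj Jne Jlb).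
  by exists x.
have par u v : rdot (u - v) (u - v) = 2 * J u + 2 * J v - 4 * J (rscale 2^-1 (u + v)).
  rewrite /J lin_rscale linearD !(rdotZl, rdotZr, rdotBl, rdotBr, rdotDl, rdotDr).
  by rewrite (rdotC v u); field.
pose x_ n := xget 0 [set x | J x < m + n.+1%:R^-1].
have x_P n : J (x_ n) < m + n.+1%:R^-1.
  have [x xP] : exists x, J x < m + n.+1%:R^-1 by apply: near; rewrite invr_gt0.
  by rewrite /x_; case: xgetP => [? -> //|/(_ x)].
have near_e (e : R) : 0 < e -> \forall n \near \oo, n.+1%:R^-1 < e.
  move=> e0; exact: near_infty_natSinv_lt (PosNum e0).
have xc : cvgn x_.
  apply/cauchy_cvgP/cauchy_ballP => e e0.
  have [r [r0 er]] : exists r : R, 0 < r /\ e = (r%:C)%C.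
    move: e0; case: e => r i; rewrite ltcE/= => /andP[/eqP -> r0].
    by exists r.
  have h := near_e _ (divr_gt0 (exprn_gt0 2 r0) (ltr0n R 4)).
  pose P n := n.+1%:R^-1 < r ^+ 2 / 4 :> R.
  rewrite /= near_simpl; exists ([set` P], [set` P]) => //= -[i j] [/= Pi Pj].
  rewrite -ball_normE/= er normr_hnorm ltcR.
  rewrite -(@ltr_pXn2r _ 2)// ?nnegrE ?hnorm_ge0 ?ltW// -rdotxx par.
  have := mJ (rscale 2^-1 (x_ i + x_ j)); have := x_P i; have := x_P j.
  have {}Pi : (i.+1%:R^-1 : R) < r ^+ 2 / 4 by exact: Pi.
  have {}Pj : (j.+1%:R^-1 : R) < r ^+ 2 / 4 by exact: Pj.
  move: Pi Pj; move: (i.+1%:R^-1) (j.+1%:R^-1) => ci cj.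
  move: (J _) (J _) (J _) => Ji Jj Jk; lra.
pose z := limn x_.
have var v : rdot z v = rdot (A v) y.
  have vb t n : 2 * t * (rdot (x_ n) v - rdot (A v) y) + t ^+ 2 * rdot v v
      >= - n.+1%:R^-1.
    have := mJ (x_ n + rscale t v); have := x_P n.
    rewrite /J linearD lin_rscale !(rdotZl, rdotZr, rdotDl, rdotDr).
    rewrite (rdotC v); move: (n.+1%:R^-1) => cn; lra.
  have xz : rdot (x_ n) v @[n --> \oo] --> rdot z v by exact: cvg_reC_dot.
  have lb t : 0 <= 2 * t * (rdot z v - rdot (A v) y) + t ^+ 2 * rdot v v.
    have c1 : 2 * t * (rdot (x_ n) v - rdot (A v) y) + t ^+ 2 * rdot v v + n.+1%:R^-1
       @[n --> \oo] --> 2 * t * (rdot z v - rdot (A v) y) + t ^+ 2 * rdot v v + 0.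
      apply: cvgD; last exact: cvg_harmonic.
      apply: cvgD; last exact: cvg_cst.
      by apply: cvgMl_tmp; apply: cvgB => //; exact: cvg_cst.
    rewrite -[leRHS]addr0; apply: (cvgr_to_ge c1).
    by apply: nearW => n; have := vb t n; rewrite -subr_ge0 opprK.
  apply/eqP; rewrite -subr_eq0; apply/eqP; move: lb.
  set g := rdot z v - _; set q := rdot v v => lb.
  have q0 : 0 <= q by rewrite /q rdotxx sqr_ge0.
  (* the quadratic is minimal at t = - g / q; q + 1 avoids a zero denominator *)
  have := lb (- (g / (q + 1))).
  have -> : 2 * - (g / (q + 1)) * g + (- (g / (q + 1))) ^+ 2 * q =
            - (g ^+ 2 * (q + 2) / (q + 1) ^+ 2).
    by field; rewrite gt_eqF// ltr_wpDl.
  rewrite oppr_ge0 pmulr_lle0 ?invr_gt0 ?exprn_gt0 ?ltr_wpDl//.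
  rewrite pmulr_lle0 ?ltr_wpDl// => g0; apply/eqP.
  by rewrite -sqrf_eq0 eq_le g0 sqr_ge0.
exists z => x; apply: rdot_eq_dot; first by rewrite -var rdotC.
by have := var (irot x); rewrite lin_irot rdotC !rdot_irotl => /oppr_inj ->.
Qed.

Lemma adjointP (A : {linear H -> K}) : continuous A ->
  forall x y, '[A x, y] = '[x, adjoint A y].
Proof.
move=> cA; have [B BP] := choice (fun y => @adjoint_vector A y cA).
by apply: (@getPex _ [set B : K -> H | forall x y, '[A x, y] = '[x, B y]]); exists B.
Qed.

Lemma rdot_adjoint (A : {linear H -> K}) : continuous A ->
  forall x y, rdot (adjoint A x) y = rdot x (A y).
Proof. by move=> cA x y; rewrite rdotC /rdot -adjointP// -/(rdot _ _) rdotC. Qed.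

End Adjoint.

(** * Growth of the weight products of a toral 2-isometry *)

Section Singles.
Variables (R : realType) (H : hilbertType R).

Lemma ell2_single_at m n (h : H) : ell2_single m n h (m, n) = h.
Proof. by rewrite /= eqxx. Qed.

Lemma ell2_single_inj m n : injective (@ell2_single R H m n).
Proof. by move=> h k hk; rewrite -(ell2_single_at m n h) hk ell2_single_at. Qed.

Lemma rdot_single m n (h : H) :
  rdot (ell2_single m n h) (ell2_single m n h) = rdot h h.
Proof.
rewrite /rdot /reC/=; apply: cvg_lim => //.
apply: cvg_near_cst; near=> N.
have mN : (m < N)%N by near: N; exact: nbhs_infty_gt.
have nN : (n < N)%N by near: N; exact: nbhs_infty_gt.
have z (I : nat * nat) : I != (m, n) ->
    reC '[ell2_single m n h I, ell2_single m n h I] = 0 :> R.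
  by move=> /negPf Imn; rewrite /= Imn linear0r.
rewrite /psum (bigD1 (Ordinal mN))//= [X in _ + X]big1 ?addr0; last first.
  move=> i im; rewrite big1// => j _; apply: z.
  by apply: contra_neq im => -[im _]; apply/val_inj.
rewrite (bigD1 (Ordinal nN))//= eqxx [X in _ + X]big1 ?addr0// => j jn; apply: z.
by apply: contra_neq jn => -[jn]; apply/val_inj.
Unshelve. all: by end_near. Qed.

End Singles.

Section Defect.
Variables (R : realType) (K : hilbertType R).

Lemma defect_form (S T : {linear K -> K}) (x : K) :
  continuous S -> continuous T ->
  x - adjoint S (S x) - adjoint T (T x) + adjoint T (adjoint S (S (T x))) = 0 ->
  rdot x x - rdot (S x) (S x) - rdot (T x) (T x) + rdot (S (T x)) (S (T x)) = 0.
Proof.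
move=> cS cT /(congr1 (fun z => rdot z x)).
by rewrite rdot0l rdotDl !rdotBl !rdot_adjoint.
Qed.

End Defect.

Section ShiftGrowth.
Variables (R : realType) (H : hilbertType R).
Variables (W1 W2 : nat -> nat -> {linear H -> H}).
Variables (T1 T2 : {linear ell2 H -> ell2 H}).
Hypothesis TW : weighted_shift W1 W2 T1 T2.
Hypothesis Tiso : toral_2isometry T1 T2.

Let T1E m n h : T1 (ell2_single m n h) = ell2_single m.+1 n (W1 m n h).
Proof. by have [] := TW m n h. Qed.
Let T2E m n h : T2 (ell2_single m n h) = ell2_single m n.+1 (W2 m n h).
Proof. by have [] := TW m n h. Qed.

Lemma weights_commute m n h : W1 m n.+1 (W2 m n h) = W2 m.+1 n (W1 m n h).
Proof.
have [_ _ TC _] := Tiso; have := TC (ell2_single m n h).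
by rewrite !(T1E, T2E) => /ell2_single_inj.
Qed.

Lemma weights_toral m n (h : H) : let q (x : H) := rdot x x in
  [/\ q h - 2 * q (W1 m n h) + q (W1 m.+1 n (W1 m n h)) = 0,
      q h - 2 * q (W2 m n h) + q (W2 m n.+1 (W2 m n h)) = 0 &
      q h - q (W1 m n h) - q (W2 m n h) + q (W1 m n.+1 (W2 m n h)) = 0].
Proof.
have [c1 c2 _ /(_ (ell2_single m n h))[d11 d12 _ d22]] := Tiso.
move: (defect_form c1 c1 d11) (defect_form c2 c2 d22) (defect_form c1 c2 d12).
rewrite !(T1E, T2E) !rdot_single => e1 e2 e3.
by split; lra.
Qed.

Notation P := (weight_prod W1 W2).

Lemma weight_prod_up m n h : W2 m n (P m n h) = P m n.+1 h.
Proof. by elim: m => [//|m IH] /=; rewrite -weights_commute IH. Qed.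

(** The three defect equations say that all second differences of
    (m, n) |-> |P_{m,n} h|^2 vanish, so this function is affine. *)
Lemma weight_prod_affine m n h :
  rdot (P m n h) (P m n h) = rdot h h
    + m%:R * (rdot (W1 0%N 0%N h) (W1 0%N 0%N h) - rdot h h)
    + n%:R * (rdot (W2 0%N 0%N h) (W2 0%N 0%N h) - rdot h h).
Proof.
pose u i j : R := rdot (P i j h) (P i j h).
have uE i j : u i.+1 j = rdot (W1 i j (P i j h)) (W1 i j (P i j h)) by [].
have uE2 i j : u i j.+1 = rdot (W2 i j (P i j h)) (W2 i j (P i j h)).
  by rewrite /u weight_prod_up.
have d i j : [/\ u i.+2 j = 2 * u i.+1 j - u i j,
    u i j.+2 = 2 * u i j.+1 - u i j & u i.+1 j.+1 = u i.+1 j + u i j.+1 - u i j].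
  have [] := weights_toral i j (P i j h).
  rewrite -uE -uE2 !weight_prod_up -/(u _ _).
  rewrite -[W1 i.+1 j _]/(P i.+2 j h) -[W1 i j.+1 _]/(P i.+1 j.+1 h) -!/(u _ _).
  by move=> e1 e2 e3; split; lra.
have d1 i j : u i.+1 j - u i j = u 1%N 0%N - u 0%N 0%N.
  elim: i j => [|i IH] j.
    by elim: j => [//|j IH]; have [_ _ ->] := d 0%N j; lra.
  by have := IH j; have [-> _ _] := d i j; lra.
have d2 j : u 0%N j.+1 - u 0%N j = u 0%N 1%N - u 0%N 0%N.
  by elim: j => [//|j IH]; have [_ -> _] := d 0%N j; lra.
have u0 j : u 0%N j = u 0%N 0%N + j%:R * (u 0%N 1%N - u 0%N 0%N).
  elim: j => [|j IH]; first by rewrite mul0r addr0.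
  by have := d2 j; rewrite -natr1 IH; lra.
rewrite -[rdot h h]/(u 0%N 0%N) -[rdot (W1 _ _ _) _]/(u 1%N 0%N).
rewrite -[rdot (W2 _ _ _) _]/(u 0%N 1%N) -/(u m n).
elim: m => [|m IH]; first by rewrite u0 mul0r addr0.
by have := d1 m n; rewrite -natr1 IH; lra.
Qed.

(** An affine function of m that stays nonnegative is nondecreasing. *)
Lemma initial_weights_expand h :
  rdot h h <= rdot (W1 0%N 0%N h) (W1 0%N 0%N h) /\
  rdot h h <= rdot (W2 0%N 0%N h) (W2 0%N 0%N h).
Proof.
have grow (a b : R) : 0 <= a -> (forall k, 0 <= a + k%:R * (b - a)) -> a <= b.
  move=> a0 pos; rewrite leNgt; apply/negP => ba.
  have ab : 0 < a - b by rewrite subr_gt0.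
  have := archi_boundP (divr_ge0 a0 (ltW ab)).
  by rewrite ltr_pdivrMr//; have := pos (Num.bound (a / (a - b))); lra.
have q0 (x : H) : 0 <= rdot x x by rewrite rdotxx sqr_ge0.
split; apply: grow => // k.
  by have := weight_prod_affine k 0 h; rewrite mul0r addr0 => <-.
by have := weight_prod_affine 0 k h; rewrite mul0r addr0 => <-.
Qed.

End ShiftGrowth.

Section WeightProdOperator.
Variables (R : realType) (H : hilbertType R).
Variables (W1 W2 : nat -> nat -> {linear H -> H}).

Fixpoint lin_weight_prod0 n : {linear H -> H} :=
  if n is n'.+1 then W2 0%N n' \o lin_weight_prod0 n' else idfun.

(** The same products as bundled linear maps, the form in which operators enter
    the functional calculus. *)
Fixpoint lin_weight_prod m n : {linear H -> H} :=
  if m is m'.+1 then W1 m' n \o lin_weight_prod m' n else lin_weight_prod0 n.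

Lemma lin_weight_prodE m n x : lin_weight_prod m n x = weight_prod W1 W2 m n x.
Proof.
elim: m => [|m IH] /=; last by rewrite IH.
by elim: n => [//|n IH] /=; rewrite IH.
Qed.

Lemma comp_bounded (A B : H -> H) : bounded_op A -> bounded_op B -> bounded_op (A \o B).
Proof.
move=> [M M0 AM] [N N0 BN]; exists (M * N); first exact: mulr_gt0.
move=> x /=; apply: le_trans (AM _) _.
by rewrite -mulrA; apply: ler_wpM2l (BN x); exact: ltW.
Qed.

Lemma lin_weight_prod_bounded m n :
  (forall i j, continuous (W1 i j) /\ continuous (W2 i j)) ->
  bounded_op (lin_weight_prod m n).
Proof.
move=> cW; elim: m => [|m IH] /=.
  elim: n => [|n IH] /=; first by exists 1 => // x; rewrite mul1r.
  by apply: comp_bounded => //; apply: continuous_bound; have [] := cW 0%N n.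
by apply: comp_bounded => //; apply: continuous_bound; have [] := cW m n.
Qed.

Lemma lin_weight_prod_inverse m n :
  (forall i j, invertible_op (W1 i j) /\ invertible_op (W2 i j)) ->
  exists B : {linear H -> H},
    cancel (lin_weight_prod m n) B /\ cancel B (lin_weight_prod m n).
Proof.
move=> iW; elim: m => [|m [B [BK KB]]] /=.
  elim: n => [|n [B [BK KB]]] /=; first by exists idfun.
  have [_ [V [_ VK KV]]] := iW 0%N n.
  by exists (B \o V); split => x /=; rewrite ?VK ?BK// KB KV.
have [[V [_ VK KV]] _] := iW m n.
by exists (B \o V); split => x /=; rewrite ?VK ?BK// KB KV.
Qed.

End WeightProdOperator.

(** * Projection-valued measures *)

Section Projections.
Context d (T : measurableType d) (R : realType) (H : hilbertType R).
Variable E : projection_measure T H.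
Implicit Types (A B : set T) (x y : H).

Lemma pm_sym B : measurable B -> symmetric_op (E B).
Proof. by move=> /(pm_proj E)[_ _ s] x y; rewrite /rdot s. Qed.

Lemma pm_idem B x : measurable B -> E B (E B x) = E B x.
Proof. by move=> /(pm_proj E)[_ s _]. Qed.

Lemma pm_sqnorm B x : measurable B -> rdot (E B x) (E B x) = rdot (E B x) x.
Proof. by move=> mB; rewrite -(pm_sym mB) pm_idem. Qed.

Lemma pm_le B x : measurable B -> rdot (E B x) x <= rdot x x.
Proof.
move=> mB; have := sqr_ge0 (hnorm (x - E B x)).
by rewrite -rdotxx !(rdotBl, rdotBr) (rdotC x) pm_sqnorm//; lra.
Qed.

Lemma scalar_measureE B x : measurable B ->
  scalar_measure E x B = (rdot (E B x) x)%:E.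
Proof. by move=> mB; rewrite /scalar_measure -rdotxx pm_sqnorm. Qed.

Lemma scalar_measure_mE B x : measurable B ->
  (scalar_measure E x : {measure set T -> \bar R}) B = (rdot (E B x) x)%:E.
Proof. exact: scalar_measureE. Qed.

Lemma pm_sub A B x : measurable A -> measurable B -> A `<=` B ->
  E A x = x -> E B x = x.
Proof.
by move=> mA mB /setIidr AB Ax; rewrite -Ax -pm_setI// AB.
Qed.

Lemma pm_setI_id A B x : measurable A -> measurable B ->
  E A x = x -> E B x = x -> E (A `&` B) x = x.
Proof. by move=> mA mB Ax Bx; rewrite pm_setI// Bx. Qed.

(** Additivity passes from the scalar measures <E(B) x, x> to [E] because the
    quadratic form of a symmetric operator determines it. *)
Lemma pm_setC B x : measurable B -> E (~` B) x = x - E B x.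
Proof.
move=> mB; have mBc := measurableC mB.
have -> : E (~` B) x = (idfun \- E B) x; last by [].
apply: symmetric_eq => [|y z|y] /=; first exact: pm_sym.
  by rewrite rdotBl rdotBr (pm_sym mB).
have : scalar_measure E y (B `|` ~` B) =
    (scalar_measure E y B + scalar_measure E y (~` B))%E.
  by apply: measureU => //; exact: setICr.
rewrite setUCr !scalar_measureE// pm_setT -EFinD => -[e].
by rewrite rdotBl e addrAC subrr add0r.
Qed.

Lemma pm_setC_id B x : measurable B -> E B x = 0 -> E (~` B) x = x.
Proof. by move=> mB Bx; rewrite pm_setC// Bx subr0. Qed.

Definition measurable_label (I : finType) (l : T -> I) :=
  forall i, measurable (l @^-1` [set i]).

Lemma pm_label_sum (I : finType) (l : T -> I) x : measurable_label l ->
  x = \sum_i E (l @^-1` [set i]) x.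
Proof.
move=> ml.
apply: rdot_inj => z.
have cov : \bigcup_(i in [set: I]) l @^-1` [set i] = setT.
  by apply/seteqP; split => // t _; exists (l t).
have dis : trivIset [set: I] (fun i => l @^-1` [set i]).
  by move=> i j _ _ [t [/= -> ->]].
have norm y : rdot y y = \sum_i rdot (E (l @^-1` [set i]) y) y.
  have : scalar_measure E y (\bigcup_(i in [set: I]) l @^-1` [set i]) =
      \sum_(i \in [set: I]) scalar_measure E y (l @^-1` [set i]).
    by apply: measure_fin_bigcup => //; exact: finite_finset.
  rewrite cov scalar_measureE// pm_setT => yy.
  apply: EFin_inj; rewrite yy (fsbigE (index_enum I)) ?index_enum_uniq//; last first.
    by move=> i _; rewrite mem_index_enum.
  rewrite -sumEFin; apply: eq_big => i; first by rewrite in_setT.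
  by rewrite scalar_measureE.
(* polarization of the identity of quadratic forms *)
have pol (S : {linear H -> H}) : symmetric_op S ->
    rdot (S (x + z)) (x + z) - rdot (S (x - z)) (x - z) = 4 * rdot (S x) z.
  move=> sS; rewrite linearD linearB !(rdotDl, rdotDr, rdotNl, rdotNr).
  by rewrite (sS z x) (rdotC z); ring.
apply: (@mulfI _ 4) => //; rewrite -(pol idfun)//= !norm -sumrB rdot_suml mulr_sumr.
by apply: eq_bigr => i _; rewrite pol//; exact: pm_sym.
Qed.

End Projections.
Arguments pm_sym {d T R H E B} _ x y.

(** * Local estimates for a spectral integral *)

(** The integral of |h| = h vanishes, so h = 0 almost everywhere on B. *)
Lemma Rintegral_pos_null d (T : measurableType d) (R : realType)
    (mu : {measure set T -> \bar R}) (B : set T) (h : T -> R) :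
  measurable B -> mu.-integrable B (EFin \o h) -> (forall t, B t -> 0 < h t) ->
  \int[mu]_(t in B) h t <= 0 -> mu B = 0%E.
Proof.
move=> mB ih h0 hle.
have i0 : (\int[mu]_(t in B) `|(EFin \o h) t| = 0)%E.
  rewrite (eq_integral (EFin \o h)); last first.
    by move=> t; rewrite inE => Bt; rewrite /= ger0_norm// ltW// h0.
  have fin := integrable_fin_num mB ih.
  rewrite -(fineK fin); congr (_%:E); apply/eqP; rewrite eq_le hle/=.
  by apply: Rintegral_ge0 => t Bt; rewrite ltW// h0.
have /integrableP[mh _] := ih.
have /(ae_eq_integral_abs mu mB mh)[N [mN N0 BN]] := i0.
apply/eqP; rewrite eq_le measure_ge0 andbT -N0.
apply: le_measure; rewrite ?inE//.
move=> t Bt; apply: BN => /= /(_ Bt)[] ht.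
by have := h0 _ Bt; rewrite ht ltxx.
Qed.

Section LocalEstimates.
Context d (T : measurableType d) (R : realType) (H : hilbertType R).
Variable E : projection_measure T H.
Implicit Types (B : set T) (x y : H) (f g : T -> R).

Lemma bounded_integrable x B f (M : R) : measurable B -> measurable_fun B f ->
  (forall t, B t -> `|f t| <= M) -> (scalar_measure E x).-integrable B (EFin \o f).
Proof.
move=> mB mf fM; apply: measurable_bounded_integrable => //.
  by rewrite scalar_measure_mE// ltry.
exists M; split; first exact: num_real.
by move=> y My t Bt; apply: le_trans (fM t Bt) (ltW My).
Qed.

Lemma Rintegral_osc x B f (c e : R) : measurable B ->
  (scalar_measure E x).-integrable B (EFin \o f) ->
  (forall t, B t -> `|f t - c| <= e) ->
  `|\int[scalar_measure E x]_(t in B) f t - c * rdot (E B x) x|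
    <= e * rdot (E B x) x.
Proof.
move=> mB fi fc.
have ci k : (scalar_measure E x).-integrable B (EFin \o cst k).
  by apply: (@bounded_integrable _ _ _ `|k|) => //; exact: measurable_cst.
have cE k : \int[scalar_measure E x]_(t in B) cst k t = k * rdot (E B x) x.
  by rewrite Rintegral_cst// scalar_measure_mE.
have lo : \int[scalar_measure E x]_(t in B) cst (c - e) t <=
    \int[scalar_measure E x]_(t in B) f t.
  by apply: le_Rintegral => // t /fc; rewrite ler_norml => /andP[]/=; lra.
have hi : \int[scalar_measure E x]_(t in B) f t <=
    \int[scalar_measure E x]_(t in B) cst (c + e) t.
  by apply: le_Rintegral => // t /fc; rewrite ler_norml => /andP[]/=; lra.
by move: lo hi; rewrite !cE ler_norml => lo hi; apply/andP; split; lra.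
Qed.

Variables (g : T -> R) (C : {linear H -> H}).
Hypothesis mg : measurable_fun setT g.
Hypothesis Csym : symmetric_op C.
Hypothesis CE : spectral_integral E setT g C.

Lemma spectral_localE B x : measurable B -> E B x = x ->
  rdot (C x) x = \int[scalar_measure E x]_(t in B) g t.
Proof.
move=> mB Bx; have [gi Cx] := CE x.
rewrite /rdot Cx /= /Rintegral (negligible_integral (N := ~` B))//.
- by rewrite setTD setCK.
- exact: measurableC.
- by rewrite scalar_measure_mE ?pm_setC ?Bx ?subrr ?rdot0l//; exact: measurableC.
Qed.

Let gi x B : measurable B -> (scalar_measure E x).-integrable B (EFin \o g).
Proof.
by move=> mB; have [gi _] := CE x; exact: (integrableS _ mB _ gi).
Qed.

(** When x lies in the range of E(B) and y in its kernel, x + y and x - y have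
    the same scalar measure, so polarization kills <C x, y>. *)
Lemma spectral_orthogonal B x y : measurable B -> E B x = x -> E B y = 0 ->
  rdot (C x) y = 0.
Proof.
move=> mB Bx By.
have muE A : measurable A -> scalar_measure E (x + y) A = scalar_measure E (x - y) A.
  move=> mA; have xy : rdot (E A x) y = 0.
    rewrite -Bx; have -> : E A (E B x) = E B (E A x).
      by rewrite -!pm_setI// setIC.
    by rewrite (pm_sym mB) By rdot0r.
  rewrite !scalar_measureE// linearD linearB !(rdotDl, rdotDr, rdotNl, rdotNr).
  by rewrite (pm_sym mA y x) (rdotC y) xy; congr (_%:E); lra.
have : rdot (C (x + y)) (x + y) = rdot (C (x - y)) (x - y).
  rewrite !(spectral_localE measurableT)// ?pm_setT// /Rintegral.
  by congr fine; apply: eq_measure_integral => A mA _; exact: muE.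
rewrite linearD linearB !(rdotDl, rdotDr, rdotNl, rdotNr) (Csym y) (rdotC y).
by move=> e; apply: (@mulfI _ 4) => //; lra.
Qed.

Lemma spectral_commute B x : measurable B -> C (E B x) = E B (C x).
Proof.
move=> mB.
have inv y : E B (C (E B y)) = C (E B y).
  apply: rdot_inj => z; rewrite (pm_sym mB).
  have := @spectral_orthogonal B (E B y) (z - E B z) mB.
  rewrite pm_idem// linearB/= pm_idem// subrr => /(_ erefl erefl).
  by rewrite rdotBr => /eqP; rewrite subr_eq0 => /eqP.
apply: rdot_inj => y.
rewrite -inv (pm_sym mB) Csym (pm_sym mB) inv -Csym.
by rewrite -(pm_sym mB).
Qed.

Lemma spectral_local_bound B x (c e : R) : measurable B ->
  (forall t, B t -> `|g t - c| <= e) -> E B x = x ->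
  hnorm (C x - rscale c x) <= e * hnorm x.
Proof.
move=> mB gc Bx.
pose sc : {linear H -> H} := ( *:%R (c%:C)%C).
pose S : {linear H -> H} := E B \o ((C \- sc) \o E B).
have SE y : S y = E B (C (E B y) - rscale c (E B y)) by [].
have [->|x0] := eqVneq x 0.
  by rewrite linear0 /rscale scaler0 subr0 hnorm0 mulr0.
suff : hnorm (S x) <= e * hnorm x.
  by rewrite SE Bx linearB/= -spectral_commute// lin_rscale Bx.
apply: numerical_radius => [y z|y].
  rewrite !SE (pm_sym mB) -(pm_sym mB y).
  by rewrite rdotBl rdotBr rdotZl rdotZr Csym.
rewrite SE (pm_sym mB) rdotBl rdotZl.
have EBy := pm_idem E y mB.
rewrite (spectral_localE mB)//.
have := Rintegral_osc mB (gi (E B y) mB) gc.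
rewrite EBy => /le_trans; apply.
have e0 : 0 <= e.
  have [B0|/set0P[t Bt]] := eqVneq B set0; last by apply: le_trans (gc _ Bt).
  by move: x0; rewrite -Bx B0 pm_set0 eqxx.
by rewrite ler_wpM2l// pm_sqnorm// pm_le.
Qed.

(** E(B) x lies in the range of E(B), where the scalar measure of B is the squared
    norm. *)
Lemma spectral_null B x : measurable B -> (forall y, E B y = y ->
     \int[scalar_measure E y]_(t in B) g t = rdot (C y) y ->
     scalar_measure E y B = 0%E) -> E B x = 0.
Proof.
move=> mB h; apply: hnorm0_eq0; apply/eqP; rewrite -(@eqrXn2 _ 2)// ?hnorm_ge0//.
rewrite expr0n -rdotxx.
have := h (E B x) (pm_idem E x mB).
rewrite -spectral_localE ?pm_idem// => /(_ erefl).
by rewrite scalar_measureE// pm_idem// => -[->].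
Qed.

(** A scalar measure that charged the complement would give k + c g a negative
    integral there. *)
Lemma spectral_nonneg (k c : R) :
  (forall y, 0 <= k * rdot y y + c * rdot (C y) y) ->
  measurable [set t | 0 <= k + c * g t] /\
  forall x, E [set t | 0 <= k + c * g t] x = x.
Proof.
move=> Cpos; pose B := [set t | k + c * g t < 0].
have mB : measurable B.
  have mh : measurable_fun setT (fun t => k + c * g t).
    by apply: measurable_funD => //; exact: measurable_funM.
  have -> : B = (fun t => k + c * g t) @^-1` `]-oo, 0[.
    by apply/seteqP; split => t /=; rewrite in_itv.
  by rewrite -[_ @^-1` _]setTI; exact: mh.
have -> : [set t | 0 <= k + c * g t] = ~` B.
  by apply/seteqP; split => t /=; rewrite leNgt => /negP.
split; first exact: measurableC.
move=> x; apply: pm_setC_id => //; apply: spectral_null => // y By int.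
have ki : (scalar_measure E y).-integrable B (EFin \o cst (- k)).
  by apply: (@bounded_integrable _ _ _ `|k|) => [//||t _ /=]; rewrite ?normrN.
have cgi : (scalar_measure E y).-integrable B (EFin \o (fun t => - c * g t)).
  have -> : EFin \o (fun t => - c * g t) = (fun t => (- c)%:E * (EFin \o g) t)%E.
    by apply/funext => t.
  by apply: integrableZl => //; exact: gi.
apply: (Rintegral_pos_null (h := fun t => - k + - c * g t)) => //.
- exact: (integrableD mB ki cgi).
- by move=> t /=; rewrite /B /= mulNr -opprD oppr_gt0.
- rewrite (RintegralD mB ki cgi) RintegralZl//; last exact: gi.
  rewrite Rintegral_cst// scalar_measure_mE//= By int.
  by have := Cpos y; lra.
Qed.

End LocalEstimates.

(** * Uniqueness of positive square roots *)

Section SqrtUnique.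
Variables (R : realType) (H : hilbertType R).
Implicit Types (P S : {linear H -> H}) (x y : H).

(** The cross term 2 t <P z, z> of the squared norm is nonnegative. *)
Lemma positive_shift_expands P (t : R) z : 0 <= t -> 0 <= rdot (P z) z ->
  t * hnorm z <= hnorm (P z + rscale t z).
Proof.
move=> t0 Pz; rewrite -(@ler_pXn2r _ 2)// ?nnegrE ?mulr_ge0 ?hnorm_ge0//.
rewrite exprMn -!rdotxx !(rdotDl, rdotDr, rdotZl, rdotZr) (rdotC z (P z)).
have := mulr_ge0 t0 Pz; have := sqr_ge0 (hnorm (P z)).
rewrite -rdotxx; lra.
Qed.

(** With D = P - S the equation P^2 = S^2 reads P D + D S = 0, that is
    (P + t) D = D (t - S). For t >= |S| the left factor expands norms by t and
    the right one shrinks them by t - 1, so |D| <= (1 - 1/t) |D|. *)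
Lemma positive_sqrt_unique P S : bounded_op P -> bounded_op S ->
  symmetric_op S -> (forall x, 0 <= rdot (P x) x) ->
  (forall x, rdot x x <= rdot (S x) x) ->
  (forall x, P (P x) = S (S x)) -> P =1 S.
Proof.
move=> [MP MP0 bP] [MS MS0 bS] sS Ppos S1 PS.
(* t > 1, so that the contraction factor 1 - 1/t is positive *)
pose t := MS + 1; have t1 : 1 < t by rewrite ltrDr.
have t0 : 0 < t by rewrite (lt_trans ltr01).
pose Dm : {linear H -> H} := P \- S.
have DE x : Dm x = P x - S x by [].
pose st : {linear H -> H} := *:%R (t%:C)%C.
have shrink x : hnorm (rscale t x - S x) <= (t - 1) * hnorm x.
  apply: (@numerical_radius _ _ (st \- S)%R) => [y z|y].
    by rewrite /= rdotBl rdotBr -/(rscale t y) -/(rscale t z) rdotZl rdotZr sS.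
  rewrite /= -/(rscale t y) rdotBl rdotZl ler_norml; apply/andP; split; last first.
    by have := S1 y; lra.
  have : rdot (S y) y <= MS * rdot y y.
    apply: le_trans (ler_norm _) (le_trans (rdot_CS _ _) _).
    by rewrite rdotxx expr2 mulrA ler_wpM2r ?hnorm_ge0.
  have := sqr_ge0 (hnorm y); rewrite -rdotxx /t; nra.
have sylvester x : P (Dm x) + rscale t (Dm x) = Dm (rscale t x - S x).
  rewrite !DE !(linearB P) !(linearB S)/= !lin_rscale PS /rscale scalerBr.
  by rewrite opprB [LHS]addrC addrACA [RHS]addrACA (addrC (- (_ *: S x))).
have step M : 0 <= M -> (forall x, hnorm (Dm x) <= M * hnorm x) ->
    forall x, hnorm (Dm x) <= M * ((t - 1) / t) * hnorm x.
  move=> M0 bM x.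
  have -> : M * ((t - 1) / t) * hnorm x = (M * ((t - 1) * hnorm x)) / t.
    by field; rewrite gt_eqF.
  rewrite ler_pdivlMr// mulrC.
  apply: le_trans (positive_shift_expands (ltW t0) (Ppos _)) _.
  by rewrite sylvester (le_trans (bM _))// ler_wpM2l.
pose r := (t - 1) / t.
have r0 : 0 <= r by rewrite divr_ge0 ?subr_ge0 ?ltW.
have r1 : `|r| < 1 by rewrite ger0_norm// ltr_pdivrMr// mul1r ltrBlDr ltrDl.
have M0 : 0 <= MP + MS by rewrite addr_ge0 ?ltW.
have iter n x : hnorm (Dm x) <= (MP + MS) * r ^+ n * hnorm x.
  elim: n x => [|n IH] x.
    rewrite expr0 mulr1 DE (le_trans (hnorm_add_le _ _))// hnorm_opp.
    by rewrite mulrDl lerD.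
  rewrite exprSr mulrA; apply: step IH x.
  by rewrite mulr_ge0 ?exprn_ge0.
move=> x; apply/eqP; rewrite -subr_eq0 -DE; apply/eqP/hnorm0_eq0/eqP.
rewrite eq_le hnorm_ge0 andbT.
have c0 : (MP + MS) * r ^+ n * hnorm x @[n --> \oo] --> (MP + MS) * 0 * hnorm x.
  apply: cvgMr_tmp; apply: cvgMl_tmp; exact: cvg_expr.
rewrite mulr0 mul0r in c0.
by apply: (cvgr_to_ge c0); apply: nearW => n; exact: iter.
Qed.

End SqrtUnique.

(** * Functional calculus by finite partitions *)

Section Calculus.
Context d (T : measurableType d) (R : realType) (H : hilbertType R).
Variable E : projection_measure T H.
Variable Q : set T.
Hypothesis mQ : measurable Q.
Hypothesis EQ : forall x, E Q x = x.
Implicit Types (A B P : {linear H -> H}) (f g : T -> R) (x y : H).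

Definition commutes_pm A := forall S x, measurable S -> A (E S x) = E S (A x).

Definition label_approx (I : finType) (l : T -> I) A f (e : R) :=
  forall p, Q p ->
    (forall q, Q q -> l q = l p -> `|f q - f p| <= e) /\
    (forall x, E (l @^-1` [set l p]) x = x ->
      hnorm (A x - rscale (f p) x) <= e * hnorm x).

(** The operator [A] is the integral of the bounded function [f]: finer and
    finer finite partitions make [f] almost constant on each cell, and [A]
    almost scalar, with the same value, on the range of the projection of that
    cell. In this form the functional calculus needs no integration. *)
Record represents f A : Prop := Represents {
  rep_bounded : bounded_op A;
  rep_commutes : commutes_pm A;
  rep_fun_bounded : exists2 M : R, 0 < M & forall p, Q p -> `|f p| <= M;
  rep_approx : forall e : R, 0 < e -> exists (I : finType) (l : T -> I),
    measurable_label l /\ label_approx l A f e }.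

Lemma label_approx_refine (I J : finType) (l : T -> I) (k : T -> J) A f e :
  measurable_label l -> measurable_label k -> (exists h, l =1 h \o k) ->
  label_approx l A f e -> label_approx k A f e.
Proof.
move=> ml mk [h lk] la p Qp; have [ff fA] := la p Qp; split.
  by move=> q Qq kq; apply: ff => //; rewrite !lk /= kq.
move=> x kx; apply: fA; apply: pm_sub kx => // q /= kq.
by rewrite !lk /= kq.
Qed.

(** Sums and products need both operators on one partition, the common
    refinement of the two. *)
Lemma label_approx2 f g A B (e : R) : 0 < e -> represents f A -> represents g B ->
  exists (I : finType) (l : T -> I),
    [/\ measurable_label l, label_approx l A f e & label_approx l B g e].
Proof.
move=> e0 /rep_approx/(_ e e0)[I [l [ml la]]] /rep_approx/(_ e e0)[J [k [mk ka]]].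
pose lk t := (l t, k t).
have mlk : measurable_label lk.
  move=> [i j]; have -> : lk @^-1` [set (i, j)] = l @^-1` [set i] `&` k @^-1` [set j].
    apply/seteqP; split => t; first by case=> <- <-.
    by case=> /= <- <-.
  exact: measurableI.
exists (I * J)%type, lk; split => //.
  by apply: label_approx_refine la => //; exists fst.
by apply: label_approx_refine ka => //; exists snd.
Qed.

Lemma represents_ext f g A B : (forall p, Q p -> f p = g p) -> A =1 B ->
  represents f A -> represents g B.
Proof.
move=> fg AB [[M M0 bA] cA [N N0 bf] aA]; split.
- by exists M => // x; rewrite -AB.
- by move=> S x mS; rewrite -!AB cA.
- by exists N => // p Qp; rewrite -fg// bf.
- move=> e e0; have [I [l [ml la]]] := aA e e0; exists I, l; split => // p Qp.
  have [ff fA] := la p Qp; split=> [q Qq lq|x lx]; first by rewrite -!fg// ff.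
  by rewrite -fg// -AB fA.
Qed.

Lemma represents_cst c : represents (fun=> c) ( *:%R (c%:C)%C).
Proof.
have c1 : 0 < `|c| + 1 by rewrite ltr_wpDl.
split.
- exists (`|c| + 1) => // x; rewrite -/(rscale c x) hnorm_rscale.
  by rewrite ler_wpM2r ?hnorm_ge0// lerDl.
- by move=> S x mS; rewrite -!/(rscale _ _) lin_rscale.
- by exists (`|c| + 1) => // p _; rewrite lerDl.
- move=> e e0; exists unit, (fun=> tt); split.
    by move=> []; rewrite (_ : _ @^-1` _ = setT)//; apply/seteqP; split.
  move=> p _; split => [q _ _|x _]; first by rewrite subrr normr0 ltW.
  by rewrite -/(rscale c x) subrr hnorm0 mulr_ge0 ?hnorm_ge0 ?ltW.
Qed.

Lemma represents_add f g A B : represents f A -> represents g B ->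
  represents (fun p => f p + g p) (A \+ B).
Proof.
move=> rA rB; have [[M M0 bA] cA [F F0 bf] _] := rA.
have [[N N0 bB] cB [G G0 bg] _] := rB; split.
- exists (M + N); first exact: addr_gt0.
  by move=> x /=; rewrite (le_trans (hnorm_add_le _ _))// mulrDl lerD.
- by move=> S x mS /=; rewrite cA// cB// linearD.
- exists (F + G); first exact: addr_gt0.
  by move=> p Qp; rewrite (le_trans (ler_normD _ _))// lerD ?bf ?bg.
- move=> e e0; have e2 : 0 < e / 2 by rewrite divr_gt0.
  have [I [l [ml la lb]]] := label_approx2 e2 rA rB.
  exists I, l; split => // p Qp.
  have [ff fA] := la p Qp; have [gg gB] := lb p Qp; split.
    move=> q Qq lq; rewrite opprD addrACA (le_trans (ler_normD _ _))//.
    by rewrite (splitr e) lerD ?ff ?gg.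
  move=> x lx /=; rewrite rscaleDl opprD addrACA.
  rewrite (le_trans (hnorm_add_le _ _))// (splitr e) mulrDl.
  by rewrite lerD ?fA ?gB.
Qed.

Lemma represents_comp f g A B : represents f A -> represents g B ->
  represents (fun p => f p * g p) (A \o B).
Proof.
move=> rA rB; have [[M M0 bA] cA [F F0 bf] _] := rA.
have [[N N0 bB] cB [G G0 bg] _] := rB; split.
- exact: comp_bounded (rep_bounded rA) (rep_bounded rB).
- by move=> S x mS /=; rewrite cB// cA.
- exists (F * G); first exact: mulr_gt0.
  by move=> p Qp; rewrite normrM ler_pM ?bf ?bg.
- move=> e e0; pose K := M + F + G.
  have K0 : 0 < K by rewrite !addr_gt0.
  have eK : 0 < e / K by rewrite divr_gt0.
  have KE : K * (e / K) = e by rewrite mulrC divfK// gt_eqF.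
  have [I [l [ml la lb]]] := label_approx2 eK rA rB.
  exists I, l; split => // p Qp.
  have [ff fA] := la p Qp; have [gg gB] := lb p Qp.
  move: (e / K) eK KE ff fA gg gB => e' e'0 KE ff fA gg gB; split.
    move=> q Qq lq.
    have -> : f q * g q - f p * g p = f q * (g q - g p) + g p * (f q - f p) by ring.
    rewrite (le_trans (ler_normD _ _))// !normrM -KE.
    have h1 : `|f q| * `|g q - g p| <= F * e' by rewrite ler_pM ?bf ?gg.
    have h2 : `|g p| * `|f q - f p| <= G * e' by rewrite ler_pM ?bg ?ff.
    have h3 : 0 <= M * e' by rewrite mulr_ge0 ?ltW.
    by rewrite /K !mulrDl; lra.
  move=> x lx /=.
  have -> : A (B x) - rscale (f p * g p) x =
      A (B x - rscale (g p) x) + rscale (g p) (A x - rscale (f p) x).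
    rewrite (linearB A)/= (lin_rscale A) rscaleBr rscaleA (mulrC (g p)).
    by rewrite subrKA.
  rewrite (le_trans (hnorm_add_le _ _))// hnorm_rscale.
  have h1 : hnorm (A (B x - rscale (g p) x)) <= M * (e' * hnorm x).
    by apply: le_trans (bA _) _; apply: ler_wpM2l; [exact: ltW|exact: gB].
  have h2 : `|g p| * hnorm (A x - rscale (f p) x) <= G * (e' * hnorm x).
    by rewrite ler_pM ?hnorm_ge0 ?bg ?fA.
  have h3 : 0 <= F * (e' * hnorm x) by rewrite !mulr_ge0 ?hnorm_ge0 ?ltW.
  by rewrite -KE /K -mulrA !mulrDl; lra.
Qed.

Lemma represents_inverse f A B : represents f A -> bounded_op B ->
  cancel A B -> cancel B A -> (forall p, Q p -> 1 <= f p) ->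
  represents (fun p => (f p)^-1) B.
Proof.
move=> rA [N N0 bB] AK BK f1; have [_ cA _ aA] := rA; split.
- by exists N.
- by move=> S x mS; rewrite -[in LHS](BK x) -cA// AK.
- exists 1 => // p Qp; have := f1 p Qp => fp.
  have fp0 : 0 < f p by rewrite (lt_le_trans ltr01).
  by rewrite ger0_norm ?invf_le1// invr_ge0 ltW.
- move=> e e0; pose K := N + 1.
  have K0 : 0 < K by rewrite addr_gt0.
  have eK : 0 < e / K by rewrite divr_gt0.
  have KE : K * (e / K) = e by rewrite mulrC divfK// gt_eqF.
  have [I [l [ml la]]] := aA _ eK.
  exists I, l; split => // p Qp; have [ff fA] := la p Qp.
  move: (e / K) eK KE ff fA => e' e'0 KE ff fA.
  have fp1 := f1 p Qp; have fp0 : 0 < f p by rewrite (lt_le_trans ltr01).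
  have ifp : 0 <= (f p)^-1 <= 1 by rewrite invr_ge0 ltW//= invf_le1.
  have /andP[ifp0 ifp1] := ifp.
  split.
    move=> q Qq lq.
    have fq1 := f1 q Qq; have fq0 : 0 < f q by rewrite (lt_le_trans ltr01).
    have -> : (f q)^-1 - (f p)^-1 = (f p - f q) * ((f p)^-1 * (f q)^-1).
      by field; rewrite !gt_eqF.
    rewrite normrM -KE distrC mulrC.
    have h : `|(f p)^-1 * (f q)^-1| <= 1.
      have ifq : 0 <= (f q)^-1 by rewrite invr_ge0 ltW.
      by rewrite ger0_norm ?mulr_ge0// mulr_ile1// invf_le1.
    apply: ler_pM => //; last exact: ff.
    by rewrite (le_trans h)// lerDr ltW.
  move=> x lx.
  have -> : B x - rscale (f p)^-1 x = - rscale (f p)^-1 (B (A x - rscale (f p) x)).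
    rewrite (linearB B)/= AK (lin_rscale B) rscaleBr rscaleA mulVf ?gt_eqF//.
    by rewrite rscale1 opprB.
  rewrite hnorm_opp hnorm_rscale ger0_norm//.
  have h : hnorm (B (A x - rscale (f p) x)) <= N * (e' * hnorm x).
    by apply: le_trans (bB _) _; apply: ler_wpM2l; [exact: ltW|exact: fA].
  have h3 : 0 <= e' * hnorm x by rewrite mulr_ge0 ?hnorm_ge0 ?ltW.
  have h4 := ler_pM ifp0 (hnorm_ge0 (B (A x - rscale (f p) x))) ifp1 h.
  by rewrite (le_trans h4)// -KE /K mul1r -mulrA mulrDl mul1r lerDl.
Qed.

(** A projection E(S) commutes with a square root P >= 1 of A: the reflection
    U = 2 E(S) - 1 commutes with A, so U P U is another square root. *)
Lemma sqrt_commutes A P : commutes_pm A -> bounded_op P -> symmetric_op P ->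
  (forall x, rdot x x <= rdot (P x) x) -> (forall x, P (P x) = A x) ->
  commutes_pm P.
Proof.
move=> cA bP sP P1 PA S x mS.
have [U UE] : exists U : {linear H -> H}, forall y, U y = E S y + E S y - y.
  by exists ((E S \+ E S) \- idfun).
have UU y : U (U y) = y.
  rewrite !UE linearB linearD/= pm_idem//.
  by rewrite addrK opprB addrC subrK.
have Usym : symmetric_op U.
  by move=> y z; rewrite !UE rdotBl rdotDl rdotBr rdotDr (pm_sym mS).
have Unorm y : hnorm (U y) = hnorm y.
  apply/eqP; rewrite -(@eqrXn2 _ 2)// ?hnorm_ge0//.
  by rewrite -!rdotxx Usym UU.
have UA y : U (A y) = A (U y) by rewrite !UE linearB linearD/= cA.
have eqPS : P =1 U \o (P \o U).
  apply: positive_sqrt_unique => //.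
  - have [M M0 bM] := bP; exists M => // y /=.
    by rewrite Unorm (le_trans (bM _))// Unorm.
  - by move=> y z /=; rewrite Usym sP Usym.
  - by move=> y; rewrite (le_trans _ (P1 y))// rdotxx sqr_ge0.
  - by move=> y /=; rewrite Usym (le_trans _ (P1 _))// -{1}(UU y) -Usym.
  - by move=> y /=; rewrite UU !PA UA UU.
have UP : U (P x) = P (U x) by rewrite (eqPS x) /= UU.
have : E S (P x) + E S (P x) - P x = P (E S x) + P (E S x) - P x.
  by rewrite -UE UP UE linearB linearD.
move=> /addIr e; apply/eqP; rewrite eq_sym; apply/eqP.
have two (z : H) : z + z = rscale 2 z.
  by rewrite -[2]/(1 + 1 : R) rscaleDl rscale1.
move: e; rewrite !two => /(congr1 (rscale 2^-1)).
by rewrite !rscaleA mulVf ?pnatr_eq0// !rscale1.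
Qed.

(** On a cell where f is close to a, factor P^2 - a = (P + sqrt a) (P - sqrt a):
    the first factor expands norms by at least sqrt a >= 1. *)
Lemma represents_sqrt f A P : represents f A -> bounded_op P -> symmetric_op P ->
  (forall x, rdot x x <= rdot (P x) x) -> (forall x, P (P x) = A x) ->
  (forall p, Q p -> 1 <= f p) ->
  represents (fun p => Num.sqrt (f p)) P.
Proof.
move=> rA bP sP P1 PA f1; have [_ cA [F F0 bf] aA] := rA.
have s1 p : Q p -> 1 <= Num.sqrt (f p).
  by move=> Qp; rewrite -sqrtr1 ler_sqrt ?f1// (le_trans ler01) ?f1.
split => //.
- exact: sqrt_commutes cA bP sP P1 PA.
- exists F => // p Qp; rewrite (le_trans _ (bf p Qp))// ger0_norm ?sqrtr_ge0//.
  rewrite ger0_norm ?(le_trans ler01) ?f1//.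
  rewrite -[leRHS]sqr_sqrtr ?(le_trans ler01) ?f1//.
  by rewrite expr2 ler_peMl ?sqrtr_ge0 ?s1.
- move=> e e0; have [I [l [ml la]]] := aA e e0; exists I, l; split => // p Qp.
  have [ff fA] := la p Qp; split.
    move=> q Qq lq; apply: le_trans (ff q Qq lq).
    rewrite -[in leRHS](sqr_sqrtr (le_trans ler01 (f1 q Qq))).
    rewrite -[in leRHS](sqr_sqrtr (le_trans ler01 (f1 p Qp))).
    rewrite subr_sqr normrM ler_peMr//.
    by rewrite ger0_norm ?addr_ge0 ?sqrtr_ge0// (le_trans (s1 q Qq))// lerDl sqrtr_ge0.
  move=> x lx; apply: le_trans (fA x lx).
  have a2 := sqr_sqrtr (le_trans ler01 (f1 p Qp)).
  move: (Num.sqrt (f p)) (s1 p Qp) a2 => a a1 a2.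
  pose z := P x - rscale a x.
  have -> : A x - rscale (f p) x = P z + rscale a z.
    rewrite /z (linearB P)/= PA (lin_rscale P) rscaleBr rscaleA -expr2 a2.
    by rewrite subrKA.
  have z0 : 0 <= rdot z z by rewrite rdotxx sqr_ge0.
  apply: le_trans (positive_shift_expands (le_trans ler01 a1) (le_trans z0 (P1 z))).
  by rewrite ler_peMl ?hnorm_ge0.
Qed.

Lemma represents_integral f A : represents f A -> measurable_fun Q f ->
  spectral_integral E Q f A.
Proof.
move=> [_ cA [F F0 bf] aA] mf x.
have fi (B : set T) : measurable B -> B `<=` Q ->
    (scalar_measure E x).-integrable B (EFin \o f).
  move=> mB BQ; apply: (@bounded_integrable _ _ _ _ _ _ _ _ F) => //.
    exact: measurable_funS mf.
  by move=> t /BQ; exact: bf.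
split; first exact: fi.
pose X := rdot x x; have X0 : 0 <= X by rewrite /X rdotxx sqr_ge0.
(* the pairing with irot x is the imaginary part of <A x, x> *)
have key e : 0 < e ->
    `|rdot (A x) x - \int[scalar_measure E x]_(t in Q) f t| <= (1 + 1) * e * X /\
    `|rdot (A x) (irot x)| <= e * X.
  move=> e0; have [I [l [ml la]]] := aA e e0.
  pose S i := l @^-1` [set i]; pose X_ i := rdot (E (S i) x) (E (S i) x).
  have mS i : measurable (S i) by exact: ml.
  have X_0 i : 0 <= X_ i by rewrite /X_ rdotxx sqr_ge0.
  have sumX : \sum_i X_ i = X.
    rewrite /X {1}(pm_label_sum E x ml) rdot_suml; apply: eq_bigr => i _.
    exact: (pm_sqnorm E x (ml i)).
  have mSQ i : measurable (Q `&` S i) by apply: measurableI => //; exact: ml.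
  (* c is a value of f on the cell, or 0 if the cell misses Q: its projection
     then vanishes because E(Q) = 1 *)
  have ex i : exists c : R, (forall t, (Q `&` S i) t -> `|f t - c| <= e) /\
      hnorm (A (E (S i) x) - rscale c (E (S i) x)) <= e * hnorm (E (S i) x).
    have [SQ0|/set0P[p [Qp pi]]] := eqVneq (Q `&` S i) set0.
      exists 0; rewrite SQ0; split => //.
      have -> : E (S i) x = 0.
        by rewrite -(EQ (E (S i) x)) -(pm_setI E mQ (mS i)) SQ0 pm_set0.
      by rewrite /rscale linear0 scaler0 subr0 hnorm0 mulr0.
    exists (f p); have [ff fA] := la p Qp; split.
      by move=> t [Qt ti]; apply: ff => //; rewrite ti pi.
    by apply: fA; rewrite pi pm_idem.
  have [c cP] := choice ex.
  have AS y : rdot (A x) y = \sum_i rdot (A (E (S i) x)) (E (S i) y).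
    rewrite [in LHS](pm_label_sum E y ml) rdotC rdot_suml; apply: eq_bigr => i _.
    by rewrite rdotC -/(S i) (cA _ _ (mS i)) (pm_sym (mS i)) pm_idem.
  have cell i y : hnorm (E (S i) y) = hnorm (E (S i) x) ->
      `|rdot (A (E (S i) x)) (E (S i) y) - c i * rdot (E (S i) x) (E (S i) y)|
        <= e * X_ i.
    move=> yx; rewrite -rdotZl -rdotBl (le_trans (rdot_CS _ _))// yx.
    by rewrite /X_ rdotxx expr2 mulrA ler_wpM2r ?hnorm_ge0//; have [] := cP i.
  have intS : \int[scalar_measure E x]_(t in Q) f t =
      \sum_i \int[scalar_measure E x]_(t in Q `&` S i) f t.
    have QE : \big[setU/set0]_(i <- index_enum I) (Q `&` S i) = Q.
      rewrite -bigcup_seq; apply/seteqP; split => [t [i _ []//]|t Qt].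
      by exists (l t) => //=; rewrite mem_index_enum.
    have dis : trivIset [set` index_enum I] (fun i => Q `&` S i).
      by move=> i j _ _ [t [/= [_ <-] [_ <-]]].
    have := @integral_bigsetU_EFin _ _ _ (scalar_measure E x) I (fun i => Q `&` S i)
      f (index_enum I) mSQ (index_enum_uniq I) dis.
    have /integrableP[mEf _] := fi Q mQ (@subset_refl _ Q).
    rewrite QE => /(_ mEf).
    move=> QE'; rewrite /Rintegral QE'.
    rewrite (eq_bigr (fun i => (fine (\int[scalar_measure E x]_(t in Q `&` S i)
      (f t)%:E))%:E)) ?sumEFin// => i _.
    by rewrite fineK//; apply: integrable_fin_num => //; exact: fi.
  split.
    rewrite AS intS -sumrB (le_trans (ler_norm_sum _ _ _))// -sumX mulr_sumr.
    apply: ler_sum => i _.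
    have h1 := cell i x erefl.
    have [cf _] := cP i.
    have := Rintegral_osc (mSQ i) (fi _ (mSQ i) (@subIsetl _ _ _)) cf.
    have -> : rdot (E (Q `&` S i) x) x = X_ i.
      by rewrite pm_setI// EQ /X_ pm_sqnorm.
    rewrite distrC => h2; apply: le_trans (ler_distD (c i * X_ i) _ _) _.
    by rewrite mulrDl mul1r mulrDl lerD.
  rewrite AS (le_trans (ler_norm_sum _ _ _))// -sumX mulr_sumr.
  apply: ler_sum => i _; have := cell i (irot x).
  rewrite lin_irot.
  have -> : rdot (E (S i) x) (irot (E (S i) x)) = 0.
    by rewrite rdot_irot; exact: dotxx_Im.
  rewrite mulr0 subr0; apply.
  apply/eqP; rewrite -(@eqrXn2 _ 2)// ?hnorm_ge0// -!rdotxx.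
  by rewrite rdot_irotl irotK rdotNr opprK.
have small (a b : R) : (forall e, 0 < e -> `|a| <= e * b) -> 0 <= b -> a = 0.
  move=> h b0; apply/eqP; rewrite -normr_le0; apply/ler_addgt0Pr => e e0.
  have b1 : 0 < b + 1 by rewrite ltr_wpDl.
  rewrite add0r (le_trans (h (e / (b + 1)) _)) ?divr_gt0//.
  by rewrite mulrAC ler_pdivrMr// ler_pM2l// lerDl.
apply/eqP; rewrite eq_complex; apply/andP; split; apply/eqP => /=.
  rewrite -/(reC _) -/(rdot _ _); apply/eqP; rewrite -subr_eq0; apply/eqP.
  apply: (small _ ((1 + 1) * X)); last by rewrite mulr_ge0.
  by move=> e /key[]; rewrite (mulrC (1 + 1) e) -mulrA.
by rewrite -/(imC _) -rdot_irot; apply: (small _ X) => // e /key[].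
Qed.

End Calculus.

Section Coordinate.
Context d (T : measurableType d) (R : realType) (H : hilbertType R).
Variables (E : projection_measure T H) (Q : set T).
Hypothesis mQ : measurable Q.
Hypothesis EQ : forall x, E Q x = x.

(** The cells of the partition are cut out by the levels a, a + e, a + 2e, ...
    of [g]: a cell is labelled by the levels that its points reach. *)
Lemma represents_spectral (g : T -> R) (C : {linear H -> H}) (a b : R) :
  measurable_fun setT g -> symmetric_op C -> bounded_op C ->
  spectral_integral E setT g C -> (forall p, Q p -> a <= g p <= b) ->
  represents E Q g C.
Proof.
move=> mg sC bC CE gab; split => //.
- by move=> S x mS; exact: spectral_commute.
- exists (`|a| + `|b| + 1); first by rewrite ltr_wpDl// addr_ge0.
  move=> p /gab/andP[ga gb]; rewrite ler_norml; apply/andP; split.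
    by have := ler_norm (- a); rewrite normrN; have := normr_ge0 b; lra.
  by have := ler_norm b; have := normr_ge0 a; lra.
- move=> e e0.
  pose N := (Num.truncn (`|b - a| / e)).+1.
  have Ne : b - a < N%:R * e.
    rewrite -ltr_pdivrMr// (le_lt_trans _ (truncnS_gt _))//.
    by rewrite ler_pM2r ?invr_gt0// ler_norm.
  pose l (t : T) := [ffun k : 'I_N => a + k%:R * e <= g t].
  have ml : measurable_label l.
    move=> v.
    have -> : l @^-1` [set v] = \bigcap_(k in [set: 'I_N])
        (g @^-1` (if v k then `[a + k%:R * e, +oo[%classic
                  else `]-oo, a + k%:R * e[%classic)).
      apply/seteqP; split => [t /= <- k _|t /= h].
        rewrite ffunE /=; case: ifPn => /=; rewrite in_itv/= ?andbT// -ltNge.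
        by [].
      apply/ffunP => k; rewrite ffunE; have := h k I; case: (v k) => /=.
        by rewrite in_itv/= andbT => ->.
      by rewrite in_itv/= ltNge => /negPf ->.
    apply: fin_bigcap_measurable; first exact: finite_finset.
    move=> k _; rewrite -[_ @^-1` _]setTI.
    by case: (v k); apply: mg.
  have osc p q : Q p -> Q q -> l q = l p -> g q <= g p + e.
    move=> Qp Qq lqp; rewrite leNgt; apply/negP => gpq.
    have /andP[aq qb] := gab q Qq; have /andP[ap pb] := gab p Qp.
    have ga0 : 0 <= (g q - a) / e by rewrite divr_ge0 ?subr_ge0// ltW.
    have /andP[k1 k2] := truncn_itv ga0.
    move: (Num.truncn _) k1 k2 => k.
    rewrite ler_pdivlMr// ltr_pdivrMr// => k1 k2.
    have kN : (k < N)%N by rewrite -(ltr_nat R) -(ltr_pM2r e0); lra.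
    have := congr1 (fun v : {ffun 'I_N -> bool} => v (Ordinal kN)) lqp.
    rewrite /= !ffunE/= => lk.
    have : a + k%:R * e <= g q by lra.
    by rewrite lk; move: k2; rewrite -natr1 mulrDl mul1r; lra.
  exists {ffun 'I_N -> bool}, l; split => // p Qp.
  have near q : Q q -> l q = l p -> `|g q - g p| <= e.
    move=> Qq lqp; rewrite ler_norml; apply/andP; split.
      by have := osc q p Qq Qp (esym lqp); lra.
    by have := osc p q Qp Qq lqp; lra.
  split => // x lx.
  have mS := ml (l p).
  apply: (spectral_local_bound sC CE (B := Q `&` l @^-1` [set l p])).
  - exact: measurableI.
  - by move=> t [Qt lt]; exact: near.
  - exact: pm_setI_id.
Qed.

End Coordinate.

(** * The symbols of the weights *)

Section WeightSymbols.
Variables (R : realType) (H : hilbertType R).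
Variables (W1 W2 : nat -> nat -> {linear H -> H}).
Variables (T1 T2 : {linear ell2 H -> ell2 H}).
Variable (E : projection_measure (R * R)%type H).
Hypothesis TIWP : ell2_IWP W1 W2 T1 T2.
Hypothesis Tiso : toral_2isometry T1 T2.
Hypothesis EE : joint_spectral_measure (W1 0%N 0%N) (W2 0%N 0%N) E.

Notation C1 := (W1 0%N 0%N).
Notation C2 := (W2 0%N 0%N).
Notation P := (lin_weight_prod W1 W2).
Notation Q := (`[1, opnorm C1]%classic `*` `[1, opnorm C2]%classic).

(** The symbol of P_{m,n}^2. *)
Definition growth (m n : nat) (p : R * R) : R :=
  1 + m%:R * (p.1 ^+ 2 - 1) + n%:R * (p.2 ^+ 2 - 1).

Lemma growth_ge1 m n p : Q p -> 1 <= growth m n p.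
Proof.
move=> [/=]; rewrite !in_itv/= => /andP[p1 _] /andP[p2 _].
have s1 : 0 <= p.1 ^+ 2 - 1 by rewrite subr_ge0 exprn_ege1.
have s2 : 0 <= p.2 ^+ 2 - 1 by rewrite subr_ge0 exprn_ege1.
by rewrite /growth -addrA lerDl addr_ge0// mulr_ge0.
Qed.

Let TW : weighted_shift W1 W2 T1 T2. Proof. by have [] := TIWP. Qed.

Lemma weight_prod_positive m n : positive_op (P m n).
Proof.
by have [_ _ _ Ppos] := TIWP => x; rewrite lin_weight_prodE; exact: Ppos.
Qed.

Lemma weight_prod_bounded m n : bounded_op (P m n).
Proof. by have [_ cW _ _] := TIWP; exact: lin_weight_prod_bounded. Qed.

Lemma weight_prod_sqnorm m n x : rdot (P m n x) (P m n x) = rdot x x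
  + m%:R * (rdot (C1 x) (C1 x) - rdot x x) + n%:R * (rdot (C2 x) (C2 x) - rdot x x).
Proof. by rewrite !lin_weight_prodE; exact: weight_prod_affine TW Tiso m n x. Qed.

Lemma weight_prod_expanding m n x : rdot x x <= rdot (P m n x) (P m n x).
Proof.
rewrite weight_prod_sqnorm -addrA lerDl.
have [h1 h2] := initial_weights_expand TW Tiso x.
by rewrite addr_ge0// mulr_ge0// subr_ge0.
Qed.

Lemma weight_prod_ge1 m n x : rdot x x <= rdot (P m n x) x.
Proof.
have [_ _ iW _] := TIWP; have [B [_ BK]] := lin_weight_prod_inverse m n iW.
apply: positive_expanding_ge1 BK _ x; first exact: weight_prod_positive.
exact: weight_prod_expanding.
Qed.

Let C1_sym : symmetric_op C1.
Proof. exact: (positive_symmetric (weight_prod_positive 1 0)). Qed.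

Let C2_sym : symmetric_op C2.
Proof. exact: (positive_symmetric (weight_prod_positive 0 1)). Qed.

Let bC1 : bounded_op C1. Proof. exact: (weight_prod_bounded 1 0). Qed.
Let bC2 : bounded_op C2. Proof. exact: (weight_prod_bounded 0 1). Qed.

Lemma quadratic_le_opnorm (A : {linear H -> H}) x : bounded_op A ->
  rdot (A x) x <= opnorm A * rdot x x.
Proof.
move=> bA; apply: le_trans (ler_norm _) (le_trans (rdot_CS _ _) _).
by rewrite rdotxx expr2 mulrA ler_wpM2r ?hnorm_ge0// hnorm_le_opnorm.
Qed.

Lemma rectangle_full x : E Q x = x.
Proof.
have [E1 E2] := EE.
have m1 : measurable_fun setT (@fst R R) by exact: measurable_fst.
have m2 : measurable_fun setT (@snd R R) by exact: measurable_snd.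
have opn (A : {linear H -> H}) y : bounded_op A ->
    0 <= opnorm A * rdot y y + -1 * rdot (A y) y.
  by move=> bA; rewrite mulN1r subr_ge0 quadratic_le_opnorm.
have ge1 (A : {linear H -> H}) y : rdot y y <= rdot (A y) y ->
    0 <= -1 * rdot y y + 1 * rdot (A y) y by lra.
have [M1 F1] := spectral_nonneg m1 E1 (fun y => ge1 C1 y (weight_prod_ge1 1 0 y)).
have [M2 F2] := spectral_nonneg m1 E1 (fun y => opn C1 y bC1).
have [M3 F3] := spectral_nonneg m2 E2 (fun y => ge1 C2 y (weight_prod_ge1 0 1 y)).
have [M4 F4] := spectral_nonneg m2 E2 (fun y => opn C2 y bC2).
have -> : Q = ([set p : R * R | 0 <= -1 + 1 * p.1] `&`
      [set p | 0 <= opnorm C1 + -1 * p.1]) `&`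
    ([set p | 0 <= -1 + 1 * p.2] `&` [set p | 0 <= opnorm C2 + -1 * p.2]).
  apply/seteqP; split => [[s t]|[s t]] /=; rewrite !in_itv/=.
    by move=> [/andP[? ?] /andP[? ?]]; split; split; lra.
  by move=> [[? ?] [? ?]]; split; apply/andP; split; lra.
by apply: pm_setI_id; [exact: measurableI|exact: measurableI|exact: pm_setI_id
  |exact: pm_setI_id].
Qed.

Let mQ : measurable Q. Proof. exact: measurableX. Qed.

(** P_{m,n}^2 is an affine combination of 1, C1^2 and C2^2, and P_{m,n} is its
    positive square root. *)
Lemma represents_weight_prod m n :
  represents E Q (fun p => Num.sqrt (growth m n p)) (P m n).
Proof.
have [E1 E2] := EE.
have r1 : represents E Q fst C1.
  apply: (represents_spectral mQ rectangle_full _ C1_sym bC1 E1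
    (a := 1) (b := opnorm C1)).
    exact: measurable_fst.
  by move=> p [/=]; rewrite in_itv.
have r2 : represents E Q snd C2.
  apply: (represents_spectral mQ rectangle_full _ C2_sym bC2 E2
    (a := 1) (b := opnorm C2)).
    exact: measurable_snd.
  by move=> p [/= _]; rewrite in_itv.
have cst c := represents_cst E Q c.
have rA := represents_add (represents_add (cst 1)
    (represents_comp (cst m%:R) (represents_add (represents_comp r1 r1) (cst (-1)))))
    (represents_comp (cst n%:R) (represents_add (represents_comp r2 r2) (cst (-1)))).
have f1 p : Q p -> 1 <= 1 + m%:R * (p.1 * p.1 + -1) + n%:R * (p.2 * p.2 + -1).
  by move=> Qp; have := growth_ge1 m n Qp; rewrite /growth !expr2.
have sP := positive_symmetric (weight_prod_positive m n).
apply: (represents_ext _ _ (represents_sqrt rA (weight_prod_bounded m n) sP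
    (weight_prod_ge1 m n) _ f1)) => [p _|//|x].
  by rewrite /growth !expr2.
apply: (symmetric_eq (A := P m n \o P m n)) => [y z|y z|y] /=.
- by rewrite !sP.
- rewrite -!/(rscale _ _) !(rdotDl, rdotDr, rdotZl, rdotZr).
  by rewrite !(C1_sym, C2_sym).
- rewrite sP weight_prod_sqnorm -!/(rscale _ _) !(rdotDl, rdotZl).
  by rewrite C1_sym C2_sym (rdotC y (C1 _)) (rdotC y (C2 _)); ring.
Qed.

(** A weight is a quotient of two consecutive products P, hence of their
    symbols. *)
Lemma weight_integral (W : {linear H -> H}) m n i j :
  (forall x, W (P m n x) = P i j x) ->
  spectral_integral E Q (fun p => Num.sqrt (growth i j p / growth m n p)) W.
Proof.
move=> WP; have [_ _ iW _] := TIWP.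
have [B [PK BK]] := lin_weight_prod_inverse m n iW.
have bB : bounded_op B.
  exists 1 => // x; rewrite mul1r hnorm_sq_le ?hnorm_ge0// -rdotxx.
  by rewrite -[in leRHS](BK x) weight_prod_expanding.
have s1 p : Q p -> 1 <= Num.sqrt (growth m n p).
  by move=> Qp; rewrite -sqrtr1 ler_sqrt ?(le_trans ler01) ?growth_ge1.
have rB := represents_inverse (represents_weight_prod m n) bB PK BK s1.
apply: represents_integral => //; first exact: rectangle_full.
  apply: represents_ext (represents_comp (represents_weight_prod i j) rB).
    move=> p Qp; rewrite sqrtrM ?(le_trans ler01 (growth_ge1 _ _ Qp))//.
    by rewrite sqrtrV// (le_trans ler01 (growth_ge1 _ _ Qp)).
  by move=> x /=; rewrite -WP BK.
have mgr k l : measurable_fun Q (growth k l).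
  apply: measurable_funD.
    apply: measurable_funD => //; apply: measurable_funM => //.
    apply: measurable_funB => //; apply: measurable_funX.
    by apply: measurable_funTS; exact: measurable_fst.
  apply: measurable_funM => //; apply: measurable_funB => //.
  by apply: measurable_funX; apply: measurable_funTS; exact: measurable_snd.
apply: (eq_measurable_fun
    (fun p => (growth i j p * (growth m n p `^ (-1))) `^ (2^-1))).
  move=> p; rewrite inE => Qp.
  have g0 := le_trans ler01 (growth_ge1 m n Qp).
  have g0' := le_trans ler01 (growth_ge1 i j Qp).
  by rewrite powR12_sqrt ?powR_inv1 ?divr_ge0.
apply: (measurableT_comp (measurable_powR _)).
apply: measurable_funM => //.
exact: (measurableT_comp (measurable_powR _)).
Qed.

End WeightSymbols.

Theorem proposition6 (R : realType) (H : hilbertType R)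
    (W1 W2 : nat -> nat -> {linear H -> H})
    (T1 T2 : {linear ell2 H -> ell2 H})
    (a1 a2 : R) (E : projection_measure (R * R)%type H)
    (sepH : separable_space H)
    (TIWP : ell2_IWP W1 W2 T1 T2)
    (Tiso : toral_2isometry T1 T2)
    (Wcomm : forall h : H, W1 0%N 0%N (W2 0%N 0%N h) = W2 0%N 0%N (W1 0%N 0%N h))
    (a1E : a1 = opnorm (W1 0%N 0%N))
    (a2E : a2 = opnorm (W2 0%N 0%N))
    (EE : joint_spectral_measure (W1 0%N 0%N) (W2 0%N 0%N) E) :
  let Q : set (R * R) := `[1, a1]%classic `*` `[1, a2]%classic in
  (forall h : H, E Q h = h) /\
  forall m n : nat,
    spectral_integral E Q
      (fun p : R * R => Num.sqrt
        ((1 + m.+1%:R * (p.1 ^+ 2 - 1) + n%:R * (p.2 ^+ 2 - 1)) /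
         (1 + m%:R * (p.1 ^+ 2 - 1) + n%:R * (p.2 ^+ 2 - 1))))
      (W1 m n) /\
    spectral_integral E Q
      (fun p : R * R => Num.sqrt
        ((1 + m%:R * (p.1 ^+ 2 - 1) + n.+1%:R * (p.2 ^+ 2 - 1)) /
         (1 + m%:R * (p.1 ^+ 2 - 1) + n%:R * (p.2 ^+ 2 - 1))))
      (W2 m n).
Proof.
rewrite {}a1E {}a2E; split; first exact: rectangle_full TIWP Tiso EE.
have [TW _ _ _] := TIWP.
move=> m n; split; apply: (weight_integral TIWP Tiso EE) => x //.
by rewrite !lin_weight_prodE; exact: weight_prod_up TW Tiso m n x.
Qed.
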